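(* Let $n_0=2^\beta$ with $\beta\in\mathbb{N}$, let $f_{A\{0\}},f_{B\{0\}},f_{C\{0\}},p_A,p_{\hat C}$ be trigonometric polynomials, and let $A\{\ell\},B\{\ell\},C\{\ell\},\hat C\{\ell\},\alpha_\ell,\hat{\mathcal{A}}_{2n_\ell}\{\ell\},\mathcal{P}\{\ell\}$ be defined by the multigrid recursion described in the context. Suppose that: - $f_{A\{0\}}(0)=0$ and $f_{A\{0\}}(\theta)>0$ for all $\theta\in(0,2\pi)$; - $f_{C\{0\}}\ge 0$; - $f_{B\{0\}}(0)=0$, $f_{B\{0\}}(\theta)\ne0$ for all $\theta\in(0,2\pi)$, and $\limsup_{\theta\to0}\frac{|f_{B\{0\}}|^2(\theta)}{f_{A\{0\}}(\theta)}<\infty$; - $0<\alpha_0<\frac{2\hat a_0(f_{A\{0\}})}{\|f_{A\{0\}}\|_\infty}$; - $|p_A|^2(\theta)+|p_A|^2(\theta+\pi)>0$ and $|p_{\hat C}|^2(\theta)+|p_{\hat C}|^2(\theta+\pi)>0$ for all $\theta\in[0,2\pi]$; - $\limsup_{\theta\to0}\frac{|p_A|^2(\theta+\pi)}{f_{A\{0\}}(\theta)}<\infty$ and $\limsup_{\theta\to0}\frac{|p_{\hat C}|^2(\theta+\pi)}{f_{\hat C\{0\}}(\theta)}<\infty$; - $|p_A|^2(\theta)+|p_{\hat C}|^2(\theta+\pi)>0$ for all $\theta\in[0,2\pi]$. For each level $\ell\ge0$ let $\omega_\ell$ satisfy $$0<\omega_\ell<2\min\left(2\alpha_\ell-\frac{\alpha_\ell^2}{\hat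 a_0(f_{A\{\ell\}})}\|f_{A\{\ell\}}\|_\infty,\ \hat a_0(f_{\hat C\{\ell\}})\left\|f_{C\{\ell\}}+\frac{|f_{B\{\ell\}}|^2}{f_{A\{\ell\}}}\right\|_\infty^{-1}\right).$$ Then, for each level $\ell\geq 0$, $$\rho\left(\mathrm{TGM}\left(\hat{\mathcal{A}}_{2n_\ell}\{\ell\},\mathcal{P}\{\ell\},\omega_\ell\right)\right)<1.$$
   Context: Circulants. For a trigonometric polynomial $f$, $\hat a_j(f)=\frac1{2\pi}\int_{-\pi}^{\pi}f(\theta)e^{-\mathrm{i}j\theta}\,d\theta$ and $\mathcal{C}_n(f)=\mathbb{F}_n\,\mathrm{diag}_{j=1,\dots,n}\big(f(\theta_{j,n})\big)\mathbb{F}_n^H$, where $\theta_{j,n}=\frac{2\pi(j-1)}{n}$ and $(\mathbb{F}_n)_{i,j}=\frac1{\sqrt n}e^{\mathrm{i}(i-1)\theta_{j,n}}$; $f$ is called the symbol. $D_X$ is the diagonal matrix with the same main diagonal as $X$. $\|\cdot\|_\infty$ is the (essential) supremum norm over $[0,2\pi]$, quotients being considered off the zeros of the denominator. For even $n$, $K_n\in\mathbb{R}^{\frac n2\times n}$ has $(K_n)_{i,2i-1}=1$ for $i=1,\dots,n/2$ and zeros elsewhere. Recursion. Let $n_{\ell+1}=n_\ell/2$. Set $A\{0\}=\mathcal{C}_{n_0}(f_{A\{0\}})$, $B\{0\}=\mathcal{C}_{n_0}(f_{B\{0\}})$, $C\{0\}=\mathcal{C}_{n_0}(f_{C\{0\}})$.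 At each level $\ell$ put $\alpha_\ell=\|D_{A\{\ell\}}^{-1}A\{\ell\}\|_2^{-1}$, $P_{A\{\ell\}}=\mathcal{C}_{n_\ell}(p_A)K_{n_\ell}^T$, $P_{\hat C\{\ell\}}=\mathcal{C}_{n_\ell}(p_{\hat C})K_{n_\ell}^T$, $\mathcal{P}\{\ell\}=\begin{bmatrix}P_{A\{\ell\}}&0\\ 0&P_{\hat C\{\ell\}}\end{bmatrix}$, and $$\hat C\{\ell\}=C\{\ell\}+B\{\ell\}\left(2\alpha_\ell D_{A\{\ell\}}^{-1}-\alpha_\ell^2D_{A\{\ell\}}^{-1}A\{\ell\}D_{A\{\ell\}}^{-1}\right)B\{\ell\}^H,$$ $$A\{\ell+1\}=P_{A\{\ell\}}^HA\{\ell\}P_{A\{\ell\}},\quad B\{\ell+1\}=P_{\hat C\{\ell\}}^HB\{\ell\}\left(I_{n_\ell}-\alpha_\ell D_{A\{\ell\}}^{-1}A\{\ell\}\right)P_{A\{\ell\}},\quad C\{\ell+1\}=P_{\hat C\{\ell\}}^H\hat C\{\ell\}P_{\hat C\{\ell\}}.$$ Further, $$\hat{\mathcal{A}}_{2n_\ell}\{\ell\}=\begin{bmatrix}I&0\\ \alpha_\ell B\{\ell\}D_{A\{\ell\}}^{-1}&-I\end{bmatrix}\begin{bmatrix}A\{\ell\}&B\{\ell\}^H\\ B\{\ell\}&-C\{\ell\}\end{bmatrix}\begin{bmatrix}I&-\alpha_\ell D_{A\{\ell\}}^{-1}B\{\ell\}^H\\ 0&I\end{bmatrix}.$$ All of $A\{\ell\},B\{\ell\},C\{\ell\},\hat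 C\{\ell\}$ are circulant of size $n_\ell$, with symbols $f_{A\{\ell\}},f_{B\{\ell\}},f_{C\{\ell\}},f_{\hat C\{\ell\}}$ given recursively, with $\psi(g)(\theta)=\frac12\left[g(\tfrac\theta2)+g(\tfrac\theta2+\pi)\right]$, by $f_{A\{\ell+1\}}=\psi(|p_A|^2f_{A\{\ell\}})$, $f_{B\{\ell+1\}}=\psi\Big(\overline{p_{\hat C}}\,p_A\,f_{B\{\ell\}}\big(1-\tfrac{\alpha_\ell}{\hat a_0(f_{A\{\ell\}})}f_{A\{\ell\}}\big)\Big)$, $f_{\hat C\{\ell\}}=f_{C\{\ell\}}+\frac{\alpha_\ell|f_{B\{\ell\}}|^2}{\hat a_0(f_{A\{\ell\}})}\big(2-\frac{\alpha_\ell}{\hat a_0(f_{A\{\ell\}})}f_{A\{\ell\}}\big)$, $f_{C\{\ell+1\}}=\psi(|p_{\hat C}|^2f_{\hat C\{\ell\}})$. Standing assumption: the levels $\ell$ considered are those for which $n_\ell$ is even and, at every level $j\le\ell$, the symbols $f_{A\{j\}},f_{B\{j\}},f_{C\{j\}},f_{\hat C\{j\}}$ have degree less than $n_j$. Two-grid method. For $X\in\mathbb{C}^{N\times N}$, $P\in\mathbb{C}^{N\times k}$ of full rank $k<N$, and $\omega\in\mathbb{R}$, $$\mathrm{TGM}(X,P,\omega)=(I_N-\omega D_X^{-1}X)\left[I_N-P(P^HXP)^{-1}P^HX\right]$$ (one damped Jacobi step as post-smoother). Since the symbols vanish at the grid point $0$, the matrices $\hat{\mathcal{A}}_{2n_\ell}\{\ell\}$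 are singular, and the following convention is used: $(P^HXP)^{-1}$ is replaced by the Moore–Penrose pseudoinverse, and, since $\mathrm{TGM}(X,P,\omega)$ acts as the identity on $\ker X$, $\rho$ denotes the spectral radius of the operator induced on the quotient space $\mathbb{C}^N/\ker X$. *)

(* Defs.v *)
From HB Require Import structures.
From mathcomp Require Export all_boot all_order all_algebra.
From mathcomp Require Export all_classical all_reals all_analysis.
From mathcomp Require Export complex.

Set Implicit Arguments.
Unset Strict Implicit.
Unset Printing Implicit Defensive.

Export Order.TTheory GRing.Theory Num.Theory.
Export numFieldNormedType.Exports.
Export Normc.

#[global] Open Scope classical_set_scope.
#[global] Open Scope sesquilinear_scope.
#[global] Open Scope complex_scope.
#[global] Open Scope ring_scope.

Section LinearAlgebra.
Variable R : realType.
Local Notation C := R[i].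

Definition diag_part n (X : 'M[C]_n) : 'M[C]_n := diag_mx (\row_i X i i).

Definition vnorm2 n (v : 'cV[C]_n) : R := Num.sqrt (\sum_i normc (v i 0) ^+ 2).

Definition mxnorm2 m n (X : 'M[C]_(m, n)) : R :=
  sup [set r | exists2 v : 'cV[C]_n, vnorm2 v = 1 & r = vnorm2 (X *m v)].

(* The four Penrose equations; [mxalgebra.pinvmx] is a different partial
   inverse. *)
Definition penrose m n (X : 'M[C]_(m, n)) (Y : 'M[C]_(n, m)) : Prop :=
  [/\ X *m Y *m X = X, Y *m X *m Y = Y,
      (X *m Y)^t* = X *m Y & (Y *m X)^t* = Y *m X].

Definition mp_pinv m n (X : 'M[C]_(m, n)) : 'M[C]_(n, m) :=
  xget 0 [set Y | penrose X Y].

Lemma adjmxM m n p (X : 'M[C]_(m, n)) (Y : 'M[C]_(n, p)) :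
  (X *m Y)^t* = Y^t* *m X^t*.
Proof. by rewrite trmx_mul map_mxM. Qed.

Lemma mulmx_adj_eq0 m n (X : 'M[C]_(m, n)) : X *m X^t* = 0 -> X = 0.
Proof.
move=> X0; apply/matrixP => i j; rewrite mxE.
have /matrixP/(_ i i) := X0; rewrite !mxE => /eqP.
under eq_bigr do rewrite !mxE -normCK.
rewrite psumr_eq0 => [/allP/(_ j)|k _]; last exact: exprn_ge0.
by rewrite mem_index_enum sqrf_eq0 normr_eq0 => /(_ isT)/eqP.
Qed.

Lemma gram_unit m n (X : 'M[C]_(m, n)) : row_free X -> X *m X^t* \in unitmx.
Proof.
move=> Xfree; rewrite -row_free_unit -kermx_eq0; apply/eqP.
set K := kermx _; have KX : K *m X *m (K *m X)^t* = 0.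
  by rewrite adjmxM mulmxA -(mulmxA K) mulmx_ker mul0mx.
by have /eqP := mulmx_adj_eq0 KX; rewrite mulmx_free_eq0 // => /eqP.
Qed.

Lemma penrose_full_rank m r n (F : 'M[C]_(m, r)) (G : 'M[C]_(r, n)) :
  F^t* *m F \in unitmx -> G *m G^t* \in unitmx ->
  penrose (F *m G)
    (G^t* *m invmx (G *m G^t*) *m invmx (F^t* *m F) *m F^t*).
Proof.
set S := F^t* *m F; set T := G *m G^t*; set Y := _ *m F^t* => uF uG.
have hS : S^t* = S by rewrite /S adjmxM trmxCK.
have hT : T^t* = T by rewrite /T adjmxM trmxCK.
have hV (k : nat) (Z : 'M[C]_k) : Z^t* = Z -> (invmx Z)^t* = invmx Z.
  by move=> hZ; rewrite trmx_inv map_invmx hZ.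
have XY : F *m G *m Y = F *m invmx S *m F^t*.
  by rewrite /Y !mulmxA -(mulmxA F) -/T mulmxK.
have YX : Y *m (F *m G) = G^t* *m invmx T *m G.
  by rewrite /Y !mulmxA -(mulmxA _ (F^t*) F) -/S mulmxKV.
split.
- by rewrite XY mulmxA -(mulmxA _ (F^t*) F) -/S mulmxKV.
- by rewrite YX /Y !mulmxA -(mulmxA _ G (G^t*)) -/T mulmxKV.
- by rewrite XY !adjmxM trmxCK hV // mulmxA.
- by rewrite YX !adjmxM trmxCK hV // mulmxA.
Qed.

Lemma penrose_exists m n (X : 'M[C]_(m, n)) : exists Y, penrose X Y.
Proof.
have uF : (col_base X)^t* *m col_base X \in unitmx.
  rewrite -{2}[col_base X]trmxCK; apply: gram_unit.
  by rewrite /row_free mxrank_map mxrank_tr; exact: col_base_full.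
have uG := gram_unit (row_base_free X).
by have := penrose_full_rank uF uG; rewrite mulmx_base; eexists; eassumption.
Qed.

Lemma penrose_unique m n (X : 'M[C]_(m, n)) Y Z :
  penrose X Y -> penrose X Z -> Y = Z.
Proof.
move=> [XYX YXY hXY hYX] [XZX ZXZ hXZ hZX].
have XYZ : X *m Y = X *m Z.
  by rewrite -hXY -{1}XZX -(mulmxA (X *m Z)) adjmxM hXY hXZ mulmxA XYX.
have YXZ : Y *m X = Z *m X.
  by rewrite -hYX -{1}XZX -mulmxA mulmxA adjmxM hYX hZX -(mulmxA Z) (mulmxA X) XYX.
by rewrite -YXY -mulmxA XYZ mulmxA YXZ ZXZ.
Qed.

Lemma mp_pinvP m n (X : 'M[C]_(m, n)) : penrose X (mp_pinv X).
Proof.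
rewrite /mp_pinv; case: xgetP => [Y -> //|noY].
by have [Y XY] := penrose_exists X; have := noY Y XY.
Qed.

(* Eigenvalues of the operator v + ker X |-> M v + ker X induced by M on
   C^n / ker X: the class of v is nonzero and [M v] = lam [v].  Meaningful
   when M maps ker X into itself, as TGM X P omega does (TGM_ker). *)
Definition quot_eigenvalue n (X M : 'M[C]_n) (lam : C) : Prop :=
  exists2 v : 'cV[C]_n, X *m v != 0 & X *m (M *m v - lam *: v) = 0.

Definition quot_spectral_radius n (X M : 'M[C]_n) : R :=
  sup [set normc lam | lam in quot_eigenvalue X M].

Definition TGM n k (X : 'M[C]_n) (P : 'M[C]_(n, k)) (omega : R) : 'M[C]_n :=
  (1%:M - omega%:C *: (invmx (diag_part X) *m X)) *m
  (1%:M - P *m mp_pinv (P^t* *m X *m P) *m P^t* *m X).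

Lemma TGM_ker n k (X : 'M[C]_n) (P : 'M[C]_(n, k)) omega (v : 'cV[C]_n) :
  X *m v = 0 -> TGM X P omega *m v = v.
Proof.
move=> Xv; have XvM (p : nat) (Y : 'M[C]_(p, n)) : Y *m X *m v = 0.
  by rewrite -mulmxA Xv mulmx0.
rewrite /TGM -(mulmxA _ _ v) (mulmxBl 1%:M _ v) XvM subr0 mul1mx.
by rewrite mulmxBl mul1mx -scalemxAl XvM scaler0 subr0.
Qed.

End LinearAlgebra.

Section Symbols.
Variable R : realType.
Local Notation C := R[i].
Implicit Type f : R -> C.

Definition expi (t : R) : C := cos t +i* sin t.

Definition trig_deg_le (d : nat) f : Prop :=
  exists a : int -> C, forall t,
    f t = \sum_(k < (2 * d).+1)
            a (k%:Z - d%:Z) * expi ((k%:Z - d%:Z)%:~R * t).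

Definition trigpoly f : Prop := exists d, trig_deg_le d f.

Definition trig_deg_lt (n : nat) f : Prop :=
  exists2 d, (d < n)%N & trig_deg_le d f.

Definition fourier_coef (j : int) f : C :=
  let g t := f t * expi (- (j%:~R * t)) in
  let I h := \int[lebesgue_measure]_(t in `[(- pi : R), pi]) h t in
  ((2 * pi)^-1 : R)%:C *
    (I (fun t => complex.Re (g t)) +i* I (fun t => complex.Im (g t))).

(* Essential supremum of |f| over [0, 2 pi].  The zeros of the denominator of a
   quotient of symbols form a null set, so the value given there to the quotient
   is irrelevant.  An infinite norm is sent to 0, hence its inverse is 0. *)
Definition supnorm f : R :=
  fine (Lnorm lebesgue_measure +oo%E
          ((fun t : R => (normc (f t))%:E) \_ `[0, 2 * pi])).

Definition limsup_at0 (g : R -> R) : \bar R := limf_esup (EFin \o g) (0 : R)^'.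

Definition psi (g : R -> C) : R -> C :=
  fun t => (g (t / 2) + g (t / 2 + pi)) / 2.

(* Rows and columns are numbered from 0. *)
Definition grid (n j : nat) : R := 2 * pi * j%:R / n%:R.

Definition fourier_mx n : 'M[C]_n :=
  \matrix_(i, j) (((Num.sqrt n%:R)^-1 : R)%:C * expi (i%:R * grid n j)).

Definition circulant n f : 'M[C]_n :=
  fourier_mx n *m diag_mx (\row_j f (grid n j)) *m (fourier_mx n)^t*.

Definition cut_mx n : 'M[C]_(n./2, n) := \matrix_(i, j) ((j == i.*2 :> nat)%:R).

Definition prolong n p : 'M[C]_(n, n./2) := circulant n p *m (cut_mx n)^T.

End Symbols.

Section OneLevel.
Variable R : realType.
Local Notation C := R[i].

Record level_mats n := LevelMats {
  matA : 'M[C]_n;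
  matB : 'M[C]_n;
  matC : 'M[C]_n }.

Record level_syms := LevelSyms {
  symA : R -> C;
  symB : R -> C;
  symC : R -> C }.

Variables pA pC : R -> C.

Section Matrices.
Variables (n : nat) (M : level_mats n).
Let A := matA M.
Let B := matB M.
Let DV := invmx (diag_part A).

Definition mat_alpha : R := (mxnorm2 (DV *m A))^-1.
Let al : C := mat_alpha%:C.

Definition mat_hatC : 'M[C]_n :=
  matC M + B *m ((2 * al) *: DV - al ^+ 2 *: (DV *m A *m DV)) *m B^t*.

Definition coarse_mats : level_mats n./2 :=
  let PA := prolong n pA in
  let PC := prolong n pC in
  LevelMats (PA^t* *m A *m PA)
            (PC^t* *m B *m (1%:M - al *: (DV *m A)) *m PA)
            (PC^t* *m mat_hatC *m PC).

Definition mat_hat : 'M[C]_(n + n) :=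
  block_mx 1%:M 0 (al *: (B *m DV)) (- 1%:M) *m
  block_mx A (B^t*) B (- matC M) *m
  block_mx 1%:M (- (al *: (DV *m B^t*))) 0 1%:M.

Definition mat_prolong : 'M[C]_(n + n, n./2 + n./2) :=
  block_mx (prolong n pA) 0 0 (prolong n pC).

End Matrices.

Section SymbolStep.
Variables (alpha : R) (F : level_syms).
Let r : C := alpha%:C / fourier_coef 0 (symA F).

Definition sym_hatC : R -> C := fun t =>
  symC F t + r * `|symB F t| ^+ 2 * (2 - r * symA F t).

Definition coarse_syms : level_syms :=
  LevelSyms
    (psi (fun t => `|pA t| ^+ 2 * symA F t))
    (psi (fun t => (pC t)^* * pA t * symB F t * (1 - r * symA F t)))
    (psi (fun t => `|pC t| ^+ 2 * sym_hatC t)).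

End SymbolStep.
End OneLevel.

Record mg_data (R : realType) := MGData {
  beta : nat;
  fA0 : R -> R[i];
  fB0 : R -> R[i];
  fC0 : R -> R[i];
  pA : R -> R[i];
  pC : R -> R[i] }.

Section Recursion.
Variables (R : realType) (S : mg_data R).

Definition nlev (l : nat) : nat := iter l half (2 ^ beta S)%N.

Fixpoint mats (l : nat) : level_mats R (nlev l) :=
  match l with
  | 0 => LevelMats (circulant (nlev 0) (fA0 S)) (circulant (nlev 0) (fB0 S))
                   (circulant (nlev 0) (fC0 S))
  | l'.+1 => coarse_mats (pA S) (pC S) (mats l')
  end.

Definition alpha l : R := mat_alpha (mats l).
Definition hatA l : 'M[R[i]]_(nlev l + nlev l) := mat_hat (mats l).
Definition prol l : 'M[R[i]]_(nlev l + nlev l, nlev l.+1 + nlev l.+1) :=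
  mat_prolong (pA S) (pC S) (nlev l).

Fixpoint syms (l : nat) : level_syms R :=
  match l with
  | 0 => LevelSyms (fA0 S) (fB0 S) (fC0 S)
  | l'.+1 => coarse_syms (pA S) (pC S) (alpha l') (syms l')
  end.

Definition fA l := symA (syms l).
Definition fB l := symB (syms l).
Definition fC l := symC (syms l).
Definition fhatC l := sym_hatC (alpha l) (syms l).

(* nlev l.+1 = 0 once nlev l = 1, so an even level size has to be positive for
   the level to exist. *)
Definition level_ok (l : nat) : Prop :=
  [/\ (0 < nlev l)%N, ~~ odd (nlev l) &
      forall j, (j <= l)%N ->
        [/\ trig_deg_lt (nlev j) (fA j), trig_deg_lt (nlev j) (fB j),
            trig_deg_lt (nlev j) (fC j) & trig_deg_lt (nlev j) (fhatC j)]].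

End Recursion.

(* Main.v *)
Require Import Defs.
From mathcomp Require Import ring lra zify ess_sup_inf.

Set Implicit Arguments.
Unset Strict Implicit.
Unset Printing Implicit Defensive.

(** The transformed matrix is [X = [[A, M^H], [-M, hatC]]] with
    [M = B (I - r A)] and [r = alpha / a0]: its Hermitian part is block diagonal
    and positive semidefinite, and it has the same kernel as [X] and [X^H].
    If [X T v = lam X v] and [w] is the coarse-grid-corrected [v], then [P^H X w = 0]
    by the Galerkin condition, and pairing the eigenvalue equation with [X w] gives
    [(1 - lam) conj(tau) = omega N], where [tau = w^H X w] and
    [N = (X w)^H D^-1 (X w)].  Hence [|lam| < 1] as soon as
    [0 < omega N < 2 Re tau], whatever the prolongation is.  In the Fourier basis
    this is a condition on the blocks [[a, conj m], [-m, h]], whose determinant is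
    [a h + |m|^2 = a c + |b|^2] and whose inverse has Hermitian part
    [diag(h, a) / (a c + |b|^2)]; the two bounds on [omega] are exactly what it
    needs.  Nonnegativity of [fC] is propagated from level to level on the grid
    points only, where [alpha] is the inverse of the largest value of [fA / a0]. *)

(** * Fourier matrices *)

Section Expi.
Variable R : realType.
Local Notation C := R[i].

Lemma conj_complex (x y : R) : (x +i* y)^* = x -i* y.
Proof. by []. Qed.

Lemma conj_real_complex (x : R) : (x%:C)^* = x%:C :> C.
Proof. by rewrite conj_complex oppr0. Qed.

Lemma expi0 : expi 0 = 1 :> C.
Proof. by rewrite /expi cos0 sin0. Qed.

Lemma expiD (s t : R) : expi (s + t) = expi s * expi t.
Proof. by rewrite /expi cosD sinD; apply/eqP; rewrite eq_complex /= eqxx /= addrC. Qed.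

Lemma expiN (t : R) : expi (- t) = (expi t)^*.
Proof. by rewrite /expi cosN sinN conj_complex. Qed.

Lemma expiMn (n : nat) (t : R) : expi (n%:R * t) = expi t ^+ n.
Proof.
elim: n => [|n IH]; first by rewrite mul0r expi0.
by rewrite -natr1 mulrDl mul1r expiD IH exprSr.
Qed.

Lemma expi_2pi : expi (2 * pi) = 1 :> C.
Proof. by rewrite /expi mulr_natl cos2pi sin2pi. Qed.

Lemma expi_2pi_nat (n : nat) : expi (n%:R * (2 * pi)) = 1 :> C.
Proof. by rewrite expiMn expi_2pi expr1n. Qed.

Lemma expi_neq1 (t : R) : 0 < t < 2 * pi -> expi t != 1.
Proof.
move=> /andP[t0 tpi]; rewrite eq_complex /= negb_and.
have -> : t = (t / 2) *+ 2 by rewrite -mulr_natr divfK.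
have s0 : 0 < sin (t / 2) by apply: sin_gt0_pi; apply/andP; split; lra.
have := cos2Dsin2 (t / 2); rewrite cos_mulr2n => cs.
apply/orP; left; apply/eqP => c1.
have : 0 < sin (t / 2) ^+ 2 by rewrite exprn_gt0.
by rewrite lt_neqAle eq_sym; case/andP => /eqP; lra.
Qed.

(** A geometric sum whose ratio is an [n]-th root of unity other than 1. *)
Lemma sum_expi_grid_nat n (m : nat) : (0 < m < n)%N ->
  \sum_(j < n) expi (m%:R * grid R n j) = 0.
Proof.
move=> /andP[m0 mn]; have n0 : n%:R != 0 :> R by rewrite pnatr_eq0; lia.
pose z : C := expi (m%:R * (2 * pi) / n%:R).
under eq_bigr => j _.
  rewrite (_ : _ * _ = j%:R * (m%:R * (2 * pi) / n%:R)); last first.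
    by rewrite /grid; field.
  rewrite expiMn -/z; over.
have zn : z ^+ n = 1.
  by rewrite /z -expiMn mulrCA divff // mulr1 expi_2pi_nat.
have z1 : z != 1.
  have ngt0 : 0 < n%:R :> R by rewrite ltr0n; lia.
  have mgt0 : 0 < m%:R :> R by rewrite ltr0n.
  have pi0 := pi_gt0 R.
  apply: expi_neq1; rewrite divr_gt0 ?mulr_gt0 //= ltr_pdivrMr //.
  by rewrite mulrC ltr_pM2l ?mulr_gt0 // ltr_nat.
have := subrX1 z n; rewrite zn subrr => /esym/eqP.
by rewrite mulf_eq0 subr_eq0 (negPf z1) => /eqP.
Qed.

Lemma sum_expi_grid n (m : int) : (`|m| < n)%N ->
  \sum_(j < n) expi (m%:~R * grid R n j) = ((m == 0)%:R * n%:R)%:C.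
Proof.
case: (intP m) => [|k|k] kn.
- under eq_bigr do rewrite mul0r expi0.
  by rewrite sumr_const card_ord mul1r rmorph_nat.
- by rewrite [LHS]sum_expi_grid_nat ?mul0r.
(* Negative frequencies: the sum is the conjugate of one already computed. *)
- rewrite mul0r [RHS](_ : _ = 0^*); last by rewrite conjC0.
  rewrite -[in RHS](@sum_expi_grid_nat n k.+1) ?rmorph_sum //=.
  by apply: eq_bigr => j _; rewrite mulrNz mulNr expiN.
Qed.

Lemma grid_sym (n i j : nat) : i%:R * grid R n j = j%:R * grid R n i.
Proof. by rewrite /grid; ring. Qed.

(** Entry [(j, k)] is the grid sum at frequency [k - j], whose modulus is below [n]. *)
Lemma fourier_mx_adjK n : (fourier_mx R n)^t* *m fourier_mx R n = 1%:M.
Proof.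
apply/matrixP => j k; rewrite !mxE.
have n0 : 0 < n%:R :> R by rewrite ltr0n; case: n j k => [[]|].
under eq_bigr => i _.
  rewrite !mxE rmorphM /= conj_real_complex mulrACA -expiN -expiD -rmorphM /=.
  rewrite -invfM -expr2 sqr_sqrtr ?(ltW n0) //.
  rewrite [i%:R * grid _ _ j]grid_sym [i%:R * grid _ _ k]grid_sym addrC -mulrBl.
  rewrite -[k%:R]/(k%:Z%:~R) -[j%:R]/(j%:Z%:~R) -mulrzBr; over.
rewrite -mulr_sumr sum_expi_grid; last by have := ltn_ord j; have := ltn_ord k; lia.
rewrite subr_eq0 -rmorphM /= [X in X%:C]mulrC mulfK ?(lt0r_neq0 n0) //.
by rewrite rmorph_nat eqz_nat eq_sym.
Qed.

Lemma fourier_mxK n : fourier_mx R n *m (fourier_mx R n)^t* = 1%:M.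
Proof. by apply: mulmx1C; apply: fourier_mx_adjK. Qed.

End Expi.

(** * Circulant matrices *)

Section Circulant.
Variable R : realType.
Local Notation C := R[i].
Implicit Types f g : R -> C.
Local Notation F n := (fourier_mx R n).

Definition symbol_col n (f : R -> C) (x : 'cV[C]_n) : 'cV[C]_n :=
  \col_j (f (grid R n j) * x j 0).

Lemma circulant_mul_fourier n f (x : 'cV[C]_n) :
  circulant n f *m (F n *m x) = F n *m symbol_col f x.
Proof.
rewrite /circulant -!mulmxA (mulmxA _ (F n) x) fourier_mx_adjK mul1mx.
by congr (_ *m _); apply/matrixP => i j; rewrite mul_diag_mx !mxE ord1.
Qed.

Lemma eq_circulant n f g :
  (forall j, (j < n)%N -> f (grid R n j) = g (grid R n j)) ->
  circulant n f = circulant n g.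
Proof.
move=> fg; rewrite /circulant; congr (_ *m diag_mx _ *m _).
by apply/rowP => j; rewrite !mxE fg.
Qed.

Lemma circulantM n f g :
  circulant n f *m circulant n g = circulant n (fun t => f t * g t).
Proof.
rewrite /circulant !mulmxA -(mulmxA _ ((F n)^t*) (F n)) fourier_mx_adjK mulmx1.
rewrite -(mulmxA (F n)) mulmx_diag; congr (_ *m diag_mx _ *m _).
by apply/rowP => j; rewrite !mxE.
Qed.

Lemma circulantD n f g :
  circulant n f + circulant n g = circulant n (fun t => f t + g t).
Proof.
rewrite /circulant -mulmxDl -mulmxDr -linearD; congr (_ *m diag_mx _ *m _).
by apply/rowP => j; rewrite !mxE.
Qed.

Lemma circulantZ n a f :
  a *: circulant n f = circulant n (fun t => a * f t).
Proof.
rewrite /circulant scalemxAl scalemxAr -linearZ; congr (_ *m diag_mx _ *m _).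
by apply/rowP => j; rewrite !mxE.
Qed.

Lemma circulantN n f : - circulant n f = circulant n (fun t => - f t).
Proof.
rewrite -scaleN1r circulantZ; apply: eq_circulant => j _; exact: mulN1r.
Qed.

Lemma circulant_scalar n (a : C) : a%:M = circulant n (fun=> a).
Proof.
rewrite /circulant (_ : diag_mx _ = a%:M).
  by rewrite -mulmxA mul_scalar_mx -scalemxAr fourier_mxK scalemx1.
by apply/matrixP => i j; rewrite !mxE.
Qed.

Lemma circulant_adj n f : (circulant n f)^t* = circulant n (fun t => (f t)^*).
Proof.
rewrite /circulant !adjmxM trmxCK mulmxA tr_diag_mx map_diag_mx.
by congr (_ *m diag_mx _ *m _); apply/rowP => j; rewrite !mxE.
Qed.

(** The common diagonal entry of [circulant n f]. It agrees with the zeroth Fourier coefficient as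
    long as no other frequency is aliased to 0. *)
Definition grid_mean n (f : R -> C) : C := (\sum_(j < n) f (grid R n j)) / n%:R.

Lemma circulantE n f i k : circulant n f i k =
  (\sum_(j < n) f (grid R n j) * expi ((i%:R - k%:R) * grid R n j)) / n%:R.
Proof.
rewrite /circulant -mulmxA mxE big_distrl /=; apply: eq_bigr => j _.
rewrite mul_diag_mx !mxE rmorphM /= conj_real_complex -expiN mulrBl expiD.
have n0 : 0 < n%:R :> R by rewrite ltr0n; case: n i k j => [[]|].
rewrite (_ : n%:R^-1 = ((Num.sqrt n%:R)^-1)%:C * ((Num.sqrt n%:R)^-1)%:C :> C).
  by ring.
rewrite -rmorphM -invfM -expr2 sqr_sqrtr ?(ltW n0) //.
by rewrite fmorphV rmorph_nat.
Qed.

Lemma diag_part_circulant n f : diag_part (circulant n f) = (grid_mean n f)%:M.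
Proof.
rewrite /diag_part -diag_const_mx; congr diag_mx; apply/rowP => i.
rewrite mxE circulantE [RHS]mxE /grid_mean.
by under eq_bigr do rewrite subrr mul0r expi0 mulr1.
Qed.

Lemma grid_half n j : ~~ odd n -> (j < n./2)%N ->
  grid R n j = grid R n./2 j / 2 /\ grid R n (n./2 + j) = grid R n./2 j / 2 + pi.
Proof.
move=> n_even jn; have nE : n%:R = n./2%:R * 2 :> R.
  by rewrite -natrM muln2 even_halfK.
have n0 : n./2%:R != 0 :> R by rewrite pnatr_eq0; lia.
by rewrite /grid nE natrD; split; field.
Qed.

Lemma sum_split_half n (G : nat -> C) : ~~ odd n ->
  \sum_(j < n) G j = \sum_(j < n./2) (G j + G (n./2 + j)%N).
Proof.
move=> n_even; transitivity (\sum_(j < n./2 + n./2) G j).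
  by rewrite addnn even_halfK.
by rewrite big_split_ord big_split.
Qed.

(** Even indices do not distinguish the angles [t / 2] and [t / 2 + pi]. *)
Lemma expi_even_grid (i k : nat) (t : R) :
  expi ((i.*2%:R - k.*2%:R) * (t / 2)) = expi ((i%:R - k%:R) * t) /\
  expi ((i.*2%:R - k.*2%:R) * (t / 2 + pi)) = expi ((i%:R - k%:R) * t).
Proof.
have dE (m : nat) : m.*2%:R = m%:R * 2 :> R by rewrite -muln2 natrM.
rewrite !dE; split; first by congr expi; field.
have -> : (i%:R * 2 - k%:R * 2) * (t / 2 + pi) =
  (i%:R - k%:R) * t + (i%:R * (2 * pi) - k%:R * (2 * pi)) by field.
by rewrite expiD expiD expiN !expi_2pi_nat conjC1 !mulr1.
Qed.

(** The fine frequencies [j] and [n./2 + j] alias to the coarse frequency [j], and [psi] averages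
    the values of the symbol at these two. *)
Lemma cut_circulant n f : ~~ odd n ->
  cut_mx R n *m circulant n f *m (cut_mx R n)^T = circulant n./2 (psi f).
Proof.
move=> n_even; apply/matrixP => i k.
have ltn2 (j : 'I_n./2) : (j.*2 < n)%N.
  by rewrite -[n in (_ < n)%N](even_halfK n_even) ltn_double.
have cutE p (M : 'M[C]_(n, p)) j l :
    (cut_mx R n *m M) j l = M (Ordinal (ltn2 j)) l.
  rewrite mxE (bigD1 (Ordinal (ltn2 j))) //= mxE eqxx mul1r big1 ?addr0 // => m.
  by rewrite mxE -val_eqE /= => /negPf ->; rewrite mul0r.
rewrite -[_ *m _]trmxK trmx_mul trmxK mxE cutE mxE cutE !circulantE /psi /=.
have nE : n%:R = n./2%:R * 2 :> C by rewrite -natrM muln2 even_halfK.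
rewrite (sum_split_half (fun j => f (grid R n j) *
  expi ((i.*2%:R - k.*2%:R) * grid R n j)) n_even) nE !mulr_suml.
apply: eq_bigr => j _; have [-> ->] := grid_half n_even (ltn_ord j).
have [-> ->] := expi_even_grid i k (grid R n./2 j).
by rewrite -mulrDl invfM; ring.
Qed.

End Circulant.

(** * Trigonometric polynomials *)

Section Trig.
Variable R : realType.
Local Notation C := R[i].
Implicit Types f g : R -> C.

Lemma normc_ge0 (z : C) : 0 <= normc z.
Proof. by case: z => x y; exact: sqrtr_ge0. Qed.

Lemma Re_le_normc (z : C) : complex.Re z <= normc z.
Proof.
case: z => x y /=; apply: le_trans (ler_norm x) _.
by rewrite -sqrtr_sqr ler_wsqrtr // lerDl sqr_ge0.
Qed.

Lemma normr_normc (z : C) : `|z| = (normc z)%:C.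
Proof. by []. Qed.

Lemma normc_sqr (z : C) : normc z ^+ 2 = complex.Re z ^+ 2 + complex.Im z ^+ 2.
Proof. by case: z => x y /=; rewrite sqr_sqrtr // addr_ge0 ?sqr_ge0. Qed.

Lemma Re_sum (I : Type) (r : seq I) (P : pred I) (F : I -> C) :
  complex.Re (\sum_(i <- r | P i) F i) = \sum_(i <- r | P i) complex.Re (F i).
Proof. by apply: (big_morph (@complex.Re R)) => // -[? ?] [? ?]. Qed.

Lemma Re_expi_term (a : C) (k t : R) :
  complex.Re (a * expi (k * t)) =
  complex.Re a * cos (k * t) - complex.Im a * sin (k * t).
Proof. by case: a. Qed.

(** * Integrals over a period and the zeroth Fourier coefficient *)

Definition Re_primitive (a : C) (k : int) (t : R) : R :=
  if k == 0 then complex.Re a * t else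
  (complex.Re a * sin (k%:~R * t) + complex.Im a * cos (k%:~R * t)) / k%:~R.

Lemma is_derive_Re_primitive a k (t : R) :
  is_derive t 1 (Re_primitive a k) (complex.Re (a * expi (k%:~R * t))).
Proof.
rewrite Re_expi_term /Re_primitive; have [->|k0] := eqVneq k 0.
  rewrite mul0r cos0 sin0 mulr0 subr0.
  have -> : (fun t => complex.Re a * t) = complex.Re a *: id :> (R -> R) by [].
  by apply: is_derive_eq.
have kR : k%:~R != 0 :> R by rewrite intr_eq0.
have dk : is_derive t 1 (fun x : R => k%:~R * x) (k%:~R : R).
  have -> : (fun x : R => k%:~R * x) = (k%:~R : R) *: id :> (R -> R) by [].
  by apply: is_derive_eq; exact: mulr1.
have ds := is_derive1_comp (is_derive_sin (k%:~R * t)) dk.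
have dc := is_derive1_comp (is_derive_cos (k%:~R * t)) dk.
have -> : (fun t => (complex.Re a * sin (k%:~R * t) +
                     complex.Im a * cos (k%:~R * t)) / k%:~R) =
    (complex.Re a / k%:~R) *: (sin \o (fun x : R => k%:~R * x)) +
    (complex.Im a / k%:~R) *: (cos \o (fun x : R => k%:~R * x)) :> (R -> R).
  by apply/funext => x; rewrite !fctE /= /GRing.scale /=; field.
by apply: is_derive_eq; rewrite /GRing.scale /=; field.
Qed.

Lemma trig_primitive d f (a : int -> C) :
  (forall t, f t = \sum_(k < (2 * d).+1)
     a (k%:Z - d%:Z) * expi ((k%:Z - d%:Z)%:~R * t)) ->
  forall t : R, is_derive t 1
    (\sum_(k < (2 * d).+1) Re_primitive (a (k%:Z - d%:Z)) (k%:Z - d%:Z))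
    (complex.Re (f t)).
Proof.
move=> fE t; rewrite fE Re_sum; apply: is_derive_sum => k.
exact: is_derive_Re_primitive.
Qed.

Lemma trig_deg_leZ d c f : trig_deg_le d f -> trig_deg_le d (fun t => c * f t).
Proof.
move=> [a fE]; exists (fun k => c * a k) => t.
by rewrite fE mulr_sumr; apply: eq_bigr => k _; rewrite mulrA.
Qed.

(** Applied to [- 'i%C * f], results on real parts yield those on imaginary parts. *)
Lemma ReMiE (z : C) : complex.Re (- 'i%C * z) = complex.Im z.
Proof. by case: z => x y /=; ring. Qed.

Lemma continuous_Re_expi_term (a : C) (k : R) :
  continuous (fun t => complex.Re (a * expi (k * t))).
Proof.
move=> t; rewrite (_ : (fun _ => _) =
  (fun t => complex.Re a * cos (k * t) - complex.Im a * sin (k * t))).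
  have ck : {for t, continuous (fun x : R => k * x)}.
    by apply: cvgM; [exact: cvg_cst | exact: cvg_id].
  apply: cvgB; (apply: cvgM; first exact: cvg_cst).
    exact: (continuous_comp ck (@continuous_cos R _)).
  exact: (continuous_comp ck (@continuous_sin R _)).
by apply/funext => x; rewrite Re_expi_term.
Qed.

Lemma continuous_Re_trigpoly f :
  trigpoly f -> continuous (fun t => complex.Re (f t)).
Proof.
move=> [d [a fE]].
have -> : (fun t => complex.Re (f t)) = (fun t => \sum_(k < (2 * d).+1)
    complex.Re (a (k%:Z - d%:Z) * expi ((k%:Z - d%:Z)%:~R * t))).
  by apply/funext => t; rewrite fE Re_sum.
move=> t; apply: cvg_big => [|k _]; first exact: add_continuous.
exact: continuous_Re_expi_term.
Qed.

Lemma continuous_Im_trigpoly f :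
  trigpoly f -> continuous (fun t => complex.Im (f t)).
Proof.
move=> [d df].
have -> : (fun t => complex.Im (f t)) = (fun t => complex.Re (- 'i%C * f t)).
  by apply/funext => t; rewrite ReMiE.
by apply: continuous_Re_trigpoly; exists d; apply: trig_deg_leZ.
Qed.

Lemma sin_int_pi (m : int) : sin (m%:~R * pi) = 0 :> R.
Proof.
have nat_case (k : nat) : sin (k%:R * pi) = 0 :> R.
  elim: k => [|k IH]; first by rewrite mul0r sin0.
  by rewrite -natr1 mulrDl mul1r sinDpi IH oppr0.
by case: (intP m) => [|k|k]; rewrite ?mulrNz ?mulNr ?sinN nat_case ?oppr0.
Qed.

Lemma Rintegral_Re_trig d f (a : int -> C) :
  (forall t, f t = \sum_(k < (2 * d).+1)
     a (k%:Z - d%:Z) * expi ((k%:Z - d%:Z)%:~R * t)) ->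
  \int[lebesgue_measure]_(t in `[(- pi : R), pi]) complex.Re (f t) =
  2 * pi * complex.Re (a 0).
Proof.
move=> fE; have dF := trig_primitive fE; set F := \sum_(k < _) _ in dF.
have cF : continuous F.
  by move=> t; apply/differentiable_continuous/derivable1_diffP; apply: ex_derive.
have pi0 := pi_gt0 R.
rewrite /Rintegral (@continuous_FTC2 _ _ F) /=; first last.
- by move=> t _; rewrite derive1E; apply: derive_val.
- split; first by move=> t _; apply: ex_derive.
  + by apply: cvg_at_right_filter; apply: cF.
  + by apply: cvg_at_left_filter; apply: cF.
- apply: continuous_subspaceT; apply: continuous_Re_trigpoly.
  by exists d, a.
- lra.
(* The index [d] carries frequency 0; every other term has a primitive taking equal values at [- pi]
   and [pi]. *)
rewrite /F !fct_sumE -sumrB (bigD1 (inord d)) //= big1 ?addr0.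
  rewrite inordK ?subrr /Re_primitive ?eqxx; [ring|lia].
move=> k kd; rewrite /Re_primitive; case: eqVneq => [k0|_].
  by case/eqP: kd; apply/val_inj; rewrite /= inordK; lia.
by rewrite !mulrN cosN sinN sin_int_pi; ring.
Qed.

(** Both sides equal the coefficient [a 0]. The integral kills every nonzero frequency; the grid sum
    kills those of modulus below [n], and degree less than [n] leaves no others. *)
Lemma fourier_coef0_grid_mean n f :
  trig_deg_lt n f -> fourier_coef 0 f = grid_mean n f.
Proof.
move=> [d dn [a fE]]; transitivity (a 0).
  have := Rintegral_Re_trig fE.
  have fEi t : - 'i%C * f t = \sum_(k < (2 * d).+1)
      (- 'i%C * a (k%:Z - d%:Z)) * expi ((k%:Z - d%:Z)%:~R * t).
    by rewrite fE mulr_sumr; apply: eq_bigr => k _; rewrite mulrA.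
  have := @Rintegral_Re_trig d (fun t => - 'i%C * f t) (fun k => - 'i%C * a k) fEi.
  rewrite ReMiE; under eq_Rintegral do rewrite ReMiE.
  move=> IIm IRe; rewrite /fourier_coef.
  have gE t : f t * expi (- (0 * t)) = f t by rewrite mul0r oppr0 expi0 mulr1.
  under eq_Rintegral do rewrite gE.
  under [X in _ +i* X]eq_Rintegral do rewrite gE.
  have pi0 : (pi : R) != 0 by rewrite gt_eqF // pi_gt0.
  rewrite IRe IIm; case: (a 0) => x y /=.
  rewrite (_ : _ +i* _ = (2 * pi)%:C * (x +i* y)); last by simpc.
  by rewrite mulrA -rmorphM /= mulVf ?mul1r // mulf_neq0.
have n0 : n%:R != 0 :> C by rewrite pnatr_eq0; lia.
rewrite /grid_mean; apply: (mulIf n0) => /=; rewrite divfK //.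
under eq_bigr do rewrite fE.
rewrite exchange_big /= (bigD1 (inord d)) //= [X in _ + X]big1 => [|k kd].
  rewrite inordK ?subrr; last by lia.
  under eq_bigr do rewrite mul0r expi0 mulr1.
  by rewrite sumr_const card_ord addr0 mulr_natr.
rewrite -mulr_sumr sum_expi_grid; last by have := ltn_ord k; lia.
rewrite (_ : (_ == _) = false) ?mul0r ?mulr0 //; apply/eqP => k0.
by case/eqP: kd; apply/val_inj; rewrite /= inordK; lia.
Qed.

(** * Essential suprema and limits superior *)

Lemma normc_trigpoly_bounded f : trigpoly f -> exists M : R, forall t, normc (f t) <= M.
Proof.
move=> [d [a fE]]; exists (\sum_(k < (2 * d).+1) normc (a (k%:Z - d%:Z))) => t.
rewrite fE; elim/big_ind2 : _ => [|x y z w xy zw|k _]; first by rewrite normc0.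
  exact: le_trans (le_normcD _ _) (lerD xy zw).
rewrite normcM /expi /= cos2Dsin2 sqrtr1 mulr1 //.
Qed.

Lemma supnormE f : (Lnorm lebesgue_measure +oo
    ((fun t : R => (normc (f t))%:E) \_ `[0%R, (2 * pi)%R]) < +oo)%E ->
  {ae lebesgue_measure, forall t : R, 0 <= t <= 2 * pi -> normc (f t) <= supnorm f}.
Proof.
move=> fin; have fE : Lnorm lebesgue_measure +oo%E
    ((fun t : R => (normc (f t))%:E) \_ `[0%R, (2 * pi)%R]) = (supnorm f)%:E.
  by rewrite /supnorm fineK // ge0_fin_numE // Lnorm_ge0.
(* The norm of exponent [+oo] is defined by cases on whether the whole space has positive measure,
   which holds for the real line. *)
move: fE; rewrite unlock; case: ifPn => [_ fE|]; last first.
  have := @lebesgue_measure_itv R `]-oo, +oo[; rewrite set_itvNyy /= => ->.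
  by rewrite -[(+oo + +oo)%E]/(+oo)%E lt0y.
have := @ess_sup_ge _ _ _ lebesgue_measure
  (abse \o (fun t : R => (normc (f t))%:E) \_ `[0%R, (2 * pi)%R]).
rewrite fE; apply: filterS => t /= H t02; move: H.
rewrite patchE ifT ?lee_fin; first exact/le_trans/ler_norm.
by rewrite inE /= in_itv.
Qed.

(** If the limit [L] exceeded the essential supremum, so would [normc (f t)] on a whole interval to
    the right of [t0]. Right limits allow [t0 = 0] and points where a quotient of symbols has no
    meaningful value. *)
Lemma le_supnorm f (F : R -> R) (t0 L : R) : 0 <= t0 < 2 * pi ->
  (Lnorm lebesgue_measure +oo
    ((fun t : R => (normc (f t))%:E) \_ `[0%R, (2 * pi)%R]) < +oo)%E ->
  F t @[t --> t0^'+] --> L ->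
  (\forall t \near t0^'+, F t <= normc (f t)) -> L <= supnorm f.
Proof.
move=> /andP[t00 t02] /supnormE[N [mN N0 subN]] FL Ff.
rewrite leNgt; apply/negP => sL.
have : \forall t \near t0^'+, [/\ t0 < t, t < 2 * pi & supnorm f < normc (f t)].
  near=> t; split; [by [] | near: t; exact: nbhs_right_lt |].
  apply: (@lt_le_trans _ _ (F t)); near: t => //.
  exact: (cvgr_gt L).
move=> /nbhs_ballP[e /= e0 He].
(* The interval has measure [e > 0] but, shrunk to fit the neighbourhood and [[0, 2 pi]], lies in
   the exceptional null set [N]. *)
suff : (lebesgue_measure (`]t0, (t0 + e)%R[ : set R) <= 0)%E.
  rewrite lebesgue_measure_itv /= lte_fin ltrDl e0 -EFinD lee_fin.
  by rewrite addrAC subrr add0r leNgt e0.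
rewrite -N0; apply: le_measure; rewrite ?inE //.
apply: subset_trans subN => t /=; rewrite in_itv /= => /andP[t0t te].
have [] := He t _ t0t.
  by rewrite /ball /= ltr_distlC; apply/andP; split; lra.
move=> _ t2 sf /(_ _)/wrap[]; first by apply/andP; split; lra.
by rewrite leNgt sf.
Unshelve. all: by end_near. Qed.

Lemma Lnorm_trigpoly_lty f : trigpoly f -> (Lnorm lebesgue_measure +oo
    ((fun t : R => (normc (f t))%:E) \_ `[0%R, (2 * pi)%R]) < +oo)%E.
Proof.
move=> /normc_trigpoly_bounded[M fM].
have M0 : 0 <= M := le_trans (normc_ge0 (f 0)) (fM 0).
rewrite unlock; case: ifPn => _ //; apply: (@le_lt_trans _ _ M%:E); last exact: ltry.
apply/ess_supP; apply: nearW => t /=; rewrite patchE; case: ifPn => _.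
  by rewrite abse_EFin lee_fin ger0_norm ?normc_ge0.
by rewrite abse0 lee_fin.
Qed.

Lemma limsup_at0_lty (g : R -> R) : (limsup_at0 g < +oo)%E ->
  exists M : R, \forall t \near 0^'+, g t <= M.
Proof.
move=> /ereal_inf_lt[_ [V V0 <-] Vy].
have gV t : V t -> ((g t)%:E <= ereal_sup [set (EFin \o g) x | x in V])%E.
  by move=> Vt; apply: ereal_sup_ubound; exists t.
have : \forall t \near (0:R)^'+, V t.
  have V0' : \forall t \near nbhs (0 : R), t != 0 -> V t := V0.
  rewrite near_withinE; apply: filterS V0' => t Vt t0.
  by apply: Vt; rewrite gt_eqF.
move: Vy gV; case: ereal_sup => [M| |] // _ gV HV.
  by exists M; apply: (filterS _ HV) => t /gV; rewrite lee_fin.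
(* The supremum is [-oo] here, which bounds no real value, so the bound 0 is arbitrary. *)
by exists 0; apply: (filterS _ HV) => t /gV; rewrite leeNy_eq.
Qed.

End Trig.

(** * Two-grid iteration *)

Section TwoGrid.
Variable R : realType.
Local Notation C := R[i].

Definition dotc n (u v : 'cV[C]_n) : C := (u^t* *m v) 0 0.

Lemma dotcE n (u v : 'cV[C]_n) : dotc u v = \sum_i (u i 0)^* * v i 0.
Proof. by rewrite /dotc mxE; apply: eq_bigr => i _; rewrite !mxE. Qed.

Lemma dotc_mulmxl m n (X : 'M[C]_(m, n)) u v :
  dotc (X *m u) v = dotc u (X^t* *m v).
Proof. by rewrite /dotc adjmxM mulmxA. Qed.

Lemma conj_dotc n (u v : 'cV[C]_n) : (dotc u v)^* = dotc v u.
Proof.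
rewrite !dotcE rmorph_sum; apply: eq_bigr => i _.
by rewrite rmorphM /= conjCK mulrC.
Qed.

Lemma dotcDr n (u v w : 'cV[C]_n) : dotc u (v + w) = dotc u v + dotc u w.
Proof. by rewrite /dotc mulmxDr mxE. Qed.

Lemma dotcBr n (u v w : 'cV[C]_n) : dotc u (v - w) = dotc u v - dotc u w.
Proof. by rewrite /dotc mulmxBr !mxE. Qed.

Lemma dotcZr n a (u v : 'cV[C]_n) : dotc u (a *: v) = a * dotc u v.
Proof. by rewrite /dotc -scalemxAr mxE. Qed.

Lemma dotc0r n (u : 'cV[C]_n) : dotc u 0 = 0.
Proof. by rewrite /dotc mulmx0 mxE. Qed.

Lemma dotc0l n (u : 'cV[C]_n) : dotc 0 u = 0.
Proof. by rewrite -conj_dotc dotc0r conjC0. Qed.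

Lemma mulmx_cV_eq0 m n (X : 'M[C]_(m, n)) :
  (forall y : 'cV_n, X *m y = 0) -> X = 0.
Proof.
move=> X0; apply/matrixP => i j.
by have /matrixP/(_ i 0) := X0 (delta_mx j 0); rewrite -colE !mxE.
Qed.

(* The coarse matrix inherits [ker X^H = ker (X + X^H)], so that its range
   contains the range of [P^H X]. *)
Lemma mp_pinv_galerkin n k (X : 'M[C]_n) (P : 'M[C]_(n, k)) :
  (forall z, dotc z (X *m z) + (dotc z (X *m z))^* = 0 -> X^t* *m z = 0) ->
  P^t* *m X *m P *m mp_pinv (P^t* *m X *m P) *m (P^t* *m X) = P^t* *m X.
Proof.
move=> kerX; set G := P^t* *m X *m P.
have [GYG _ hGY _] := mp_pinvP G; set Y := mp_pinv G in GYG hGY *.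
(* The orthogonal projector onto the complement of the range of [G]. *)
pose E : 'M[C]_k := 1%:M - G *m Y.
have hE : E^t* = E by rewrite /E linearB map_mxB /= hGY trmx1 map_mx1.
have EG : E *m G = 0 by rewrite /E mulmxBl mul1mx GYG subrr.
have GE : G^t* *m E = 0 by rewrite -{1}hE -adjmxM EG trmx0 map_mx0.
(* For [z = P E y] the form [z^H X z] equals [(E y)^H G (E y)], which vanishes since [E G = 0]; then
   [kerX] applies. *)
suff XPE : X^t* *m P *m E = 0.
  have : E *m (P^t* *m X) = 0.
    have := congr1 (fun Z : 'M[C]_(n, k) => Z^t*) XPE.
    by rewrite !adjmxM hE trmxCK trmx0 map_mx0.
  by rewrite /E mulmxBl mul1mx => /eqP; rewrite subr_eq0 => /eqP <-.
apply: mulmx_cV_eq0 => y; rewrite -!mulmxA; apply: kerX.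
suff -> : dotc (P *m (E *m y)) (X *m (P *m (E *m y))) = 0.
  by rewrite conjC0 addr0.
rewrite dotc_mulmxl !mulmxA -/G -mulmxA -[G]trmxCK -dotc_mulmxl.
by rewrite mulmxA GE mul0mx dotc0l.
Qed.

(** Here [lam conj(tau) = conj(tau) - s], and [|tau|^2 - |conj(tau) - s|^2 = s (tau + conj(tau) -
    s)] is positive. *)
Lemma norm_lt1_of_half_plane (lam tau s : C) :
  0 < s -> s < tau + tau^* -> (1 - lam) * tau^* = s -> `|lam| < 1.
Proof.
move=> s0 stau E; have sR : s^* = s by apply: CrealP; apply: gtr0_real.
have tau0 : tau != 0.
  by apply: contraTneq stau => ->; rewrite conjC0 addr0 lt_gtF.
have lamE : lam * tau^* = tau^* - s by rewrite -E; ring.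
rewrite -(@ltr_pXn2r _ 2) ?nnegrE ?normr_ge0 // expr1n.
rewrite -(@ltr_pM2r _ (`|tau| ^+ 2)) ?exprn_gt0 ?normr_gt0 // mul1r.
rewrite -(norm_conjC tau) -exprMn -normrM lamE !normCK conjCK rmorphB /= sR conjCK.
rewrite -subr_gt0 (_ : _ - _ = s * (tau + tau^* - s)); last by ring.
by rewrite mulr_gt0 // subr_gt0.
Qed.

Lemma TGM_quot_eigenvalue n k (X : 'M[C]_n) (P : 'M[C]_(n, k)) omega lam :
  (forall z, dotc z (X *m z) + (dotc z (X *m z))^* = 0 -> X^t* *m z = 0) ->
  (forall w, X *m w != 0 ->
     0 < omega%:C * dotc (X *m w) (invmx (diag_part X) *m (X *m w))
       < dotc w (X *m w) + (dotc w (X *m w))^*) ->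
  quot_eigenvalue X (TGM X P omega) lam -> `|lam| < 1.
Proof.
move=> kerX smooth [v Xv eig]; set Y := mp_pinv (P^t* *m X *m P).
have PXG := mp_pinv_galerkin P kerX; rewrite -/Y in PXG.
set Dv := invmx (diag_part X) in smooth.
pose y := Y *m (P^t* *m X *m v); pose w := v - P *m y.
have TGMv : TGM X P omega *m v = w - omega%:C *: (Dv *m (X *m w)).
  rewrite /TGM -/Dv -/Y -(mulmxA _ _ v) [X in _ *m X](_ : _ = w).
    by rewrite mulmxBl mul1mx -scalemxAl !mulmxA.
  by rewrite mulmxBl mul1mx /w /y !mulmxA.
have vE : v = w + P *m y by rewrite subrK.
(* If the coarse correction already sends [v] into the kernel, then [lam] annihilates a nonzero
   class, so [lam = 0]. *)
have [Xw0|Xw] := eqVneq (X *m w) 0.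
  have : lam *: (X *m v) = 0.
    move: eig; rewrite TGMv Xw0 mulmx0 scaler0 subr0 mulmxBr Xw0 sub0r.
    by rewrite -scalemxAr => /eqP; rewrite oppr_eq0 => /eqP.
  by move/eqP; rewrite scaler_eq0 (negPf Xv) orbF => /eqP ->; rewrite normr0.
(* Galerkin orthogonality of the corrected residual to the range of [P]. *)
have PXw : P^t* *m (X *m w) = 0.
  apply/eqP; rewrite /w /y !mulmxBr subr_eq0 !mulmxA -{1}PXG !mulmxA.
  by [].
clearbody w; move: eig; rewrite TGMv => eig; clear TGMv PXG.
have kerXadj (z : 'cV_n) : X *m z = 0 -> X^t* *m z = 0.
  by move=> Xz; apply: kerX; rewrite Xz dotc0r conjC0 addr0.
have /andP[s0 sw] := smooth _ Xw.
apply: (norm_lt1_of_half_plane s0 sw).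
(* The eigenvalue equation places a vector in the kernel of [X], hence of [X^H], so its product with
   [X w] is 0; the [P y] part drops out by [PXw]. *)
move: eig => /kerXadj; rewrite vE => kE.
have := dotc_mulmxl X w (w - omega%:C *: (Dv *m (X *m w)) - lam *: (w + P *m y)).
rewrite kE dotc0r !dotcBr !dotcZr dotcDr => /eqP.
rewrite (_ : dotc (X *m w) (P *m y) = 0); last first.
  by rewrite -[P]trmxCK -dotc_mulmxl PXw dotc0l.
rewrite -[dotc (X *m w) w]conj_dotc addr0.
move=> /eqP E; apply/eqP; rewrite -subr_eq0 -[eqbRHS]E; apply/eqP; ring.
Qed.

(** Since [M] fixes the kernel of [X] and [lam != 1], a class eigenvector lifts to a genuine one
    after subtracting [k / (1 - lam)]. This leaves only finitely many candidates for [lam]. *)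
Lemma quot_eigenvalue_char_poly n (X M : 'M[C]_n) lam :
  (forall v : 'cV_n, X *m v = 0 -> M *m v = v) -> lam != 1 ->
  quot_eigenvalue X M lam -> root (char_poly M^T) lam.
Proof.
move=> Mker lam1 [v Xv eig]; set k := M *m v - lam *: v in eig.
have l1 : 1 - lam != 0 by rewrite subr_eq0 eq_sym.
have Mv : M *m v = k + lam *: v by rewrite subrK.
clearbody k; pose u := v - (1 - lam)^-1 *: k.
have Mu : M *m u = lam *: u.
  rewrite /u mulmxBr -scalemxAr (Mker k) // Mv.
  by apply/matrixP => i j; rewrite !mxE; field.
rewrite -eigenvalue_root_char; apply/eigenvalueP; exists u^T.
  by rewrite -trmx_mul Mu linearZ.
apply: contra_neq Xv => /(congr1 trmx); rewrite trmxK trmx0 /u => /eqP.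
by rewrite subr_eq0 => /eqP ->; rewrite -scalemxAr eig scaler0.
Qed.

(** A supremum of numbers below 1 could still be 1; finiteness of the set of eigenvalues turns it
    into a maximum. If there is none, the supremum is 0 by convention. *)
Lemma quot_spectral_radius_lt1 n (X M : 'M[C]_n) :
  (forall v : 'cV_n, X *m v = 0 -> M *m v = v) ->
  (forall lam, quot_eigenvalue X M lam -> `|lam| < 1) ->
  quot_spectral_radius X M < 1.
Proof.
move=> Mker eig; rewrite /quot_spectral_radius.
have norm1 lam : quot_eigenvalue X M lam -> normc lam < 1.
  by move/eig; rewrite -ltcR.
have [r rE] := closed_field_poly_normal (char_poly M^T).
pose s := [seq x <- [seq normc z | z <- r] | x < 1].
have [->|/set0P ne] := eqVneq [set normc lam | lam in quot_eigenvalue X M] set0.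
  by rewrite sup0.
apply: (@le_lt_trans _ _ (\big[Num.max/0]_(x <- s) x)).
  apply: ge_sup => // _ [lam lamE <-].
  have lam1 : lam != 1.
    by apply: contraTneq (eig _ lamE) => ->; rewrite normr1 ltxx.
  have /= := @le_bigmax_seq _ R _ s 0 (normc lam) xpredT id; apply=> //.
  rewrite mem_filter norm1 //= map_f //.
  have := quot_eigenvalue_char_poly Mker lam1 lamE; rewrite rE rootZ.
    by rewrite root_prod_XsubC.
  by rewrite lead_coef_eq0 monic_neq0 // char_poly_monic.
rewrite /s big_filter; apply: (big_ind (fun x : R => x < 1)) => // x y x1 y1.
by rewrite gt_max x1.
Qed.

End TwoGrid.

(** * Block circulant matrices *)

Section BlockCirculant.
Variable R : realType.
Local Notation C := R[i].
Local Notation F n := (fourier_mx R n).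

(* The 2 x 2 frequency block [[a, m^*], [-m, h]] is smoothed by the diagonal
   (a0, h0) with damping om; the second alternative says that the Hermitian part
   diag(h, a) / (a h + |m|^2) of its inverse exceeds (om / 2) diag(1/a0, 1/h0). *)
Definition smoothed_block (om a0 h0 a h m : C) : Prop :=
  [/\ 0 <= a, 0 <= h &
    [/\ m = 0, om * a < 2 * a0 & om * h < 2 * h0] \/
    [/\ 0 < a, 0 < h, om * (a * h + `|m| ^+ 2) < 2 * a0 * h &
        om * (a * h + `|m| ^+ 2) < 2 * h0 * a]].

(** The pair [(u, v)] is the block applied to [(x, y)], and positive [p], [q] make the gap strict
    unless [u = v = 0]. In the coupled case it rests on [h |u|^2 + a |v|^2 = D (a |x|^2 + h |y|^2)]
    with [D] the determinant. *)
Lemma smoothed_block_energy om a0 h0 a h m : 0 < a0 -> 0 < h0 ->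
  smoothed_block om a0 h0 a h m ->
  exists p q : C, [/\ 0 < p, 0 < q &
    forall x y, let u := a * x + m^* * y in let v := - m * x + h * y in
      2 * (a * `|x| ^+ 2 + h * `|y| ^+ 2) =
      om * (`|u| ^+ 2 / a0 + `|v| ^+ 2 / h0) + (p * `|u| ^+ 2 + q * `|v| ^+ 2)].
Proof.
move=> a0_gt0 h0_gt0 [a_ge0 h_ge0 cases].
have aR : a^* = a by apply/CrealP/ger0_real.
have hR : h^* = h by apply/CrealP/ger0_real.
have a0_neq0 := lt0r_neq0 a0_gt0; have h0_neq0 := lt0r_neq0 h0_gt0.
case: cases => [[-> oma omh]|[a_gt0 h_gt0 omh oma]].
  have diagonal b b0 : 0 < b0 -> 0 <= b -> om * b < 2 * b0 ->
      exists2 p : C, 0 < p & forall z, 2 * (b * `|z| ^+ 2) =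
        om * (`|b * z| ^+ 2 / b0) + p * `|b * z| ^+ 2.
    move=> b0_gt0 b_ge0 omb; have b0_neq0 := lt0r_neq0 b0_gt0.
    have [->|b_neq0] := eqVneq b 0.
      (* With [b = 0] every term vanishes, so any positive weight serves. *)
      by exists 1 => // z; rewrite !mul0r normr0 expr0n /= mul0r !mulr0 addr0.
    have b_gt0 : 0 < b by rewrite lt_def b_neq0.
    exists ((2 * b0 - om * b) / (b0 * b)) => [|z].
      by rewrite divr_gt0 ?mulr_gt0 ?subr_gt0.
    by rewrite normrM (ger0_norm b_ge0) exprMn; field; rewrite ?b_neq0 ?b0_neq0.
  have [p p0 pE] := diagonal _ _ a0_gt0 a_ge0 oma.
  have [q q0 qE] := diagonal _ _ h0_gt0 h_ge0 omh.
  exists p, q; split => // x y /=; rewrite conjC0 oppr0 !mul0r addr0 add0r.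
  by rewrite mulrDr pE qE; ring.
set D := a * h + `|m| ^+ 2 in oma omh.
have D_gt0 : 0 < D by rewrite ltr_wpDr ?mulr_gt0 // exprn_ge0.
have D_neq0 := lt0r_neq0 D_gt0.
(* These are [2 h / D - om / a0] and [2 a / D - om / h0]. *)
exists ((2 * a0 * h - om * D) / (a0 * D)), ((2 * h0 * a - om * D) / (h0 * D)).
split; [by rewrite divr_gt0 ?subr_gt0 ?mulr_gt0 ..|move=> x y /=].
transitivity (2 * (h * `|a * x + m^* * y| ^+ 2 + a * `|- m * x + h * y| ^+ 2) / D).
  have -> : h * `|a * x + m^* * y| ^+ 2 + a * `|- m * x + h * y| ^+ 2 =
      D * (a * `|x| ^+ 2 + h * `|y| ^+ 2).
    rewrite /D !normCK !rmorphD !rmorphM rmorphN /= aR hR conjCK; ring.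
  by field.
by field; rewrite ?D_neq0 ?a0_neq0 ?h0_neq0.
Qed.

(** The two conclusions are the components of the adjoint block applied to [(x, y)]. *)
Lemma smoothed_block_kernel om a0 h0 a h m x y :
  smoothed_block om a0 h0 a h m -> a * `|x| ^+ 2 + h * `|y| ^+ 2 = 0 ->
  a * x - m^* * y = 0 /\ m * x + h * y = 0.
Proof.
move=> [a_ge0 h_ge0 cases] /eqP.
have sq b z : (b * `|z| ^+ 2 == 0) = (b * z == 0) :> bool.
  by rewrite mulf_eq0 sqrf_eq0 normr_eq0 -mulf_eq0.
rewrite paddr_eq0 ?mulr_ge0 ?exprn_ge0 // !sq.
case: cases => [[-> _ _]|[/gt_eqF a0' /gt_eqF h0' _ _]].
  by rewrite conjC0 !mul0r subr0 add0r => /andP[/eqP-> /eqP->].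
rewrite !mulf_eq0 a0' h0' /= => /andP[/eqP-> /eqP->].
by rewrite !mulr0 subr0 addr0.
Qed.

Lemma diag_part_block n (A B D E : 'M[C]_n) :
  diag_part (block_mx A B D E) = block_mx (diag_part A) 0 0 (diag_part E).
Proof.
rewrite /diag_part -diag_mx_row; congr diag_mx; apply/rowP => i; rewrite mxE.
case: (split_ordP i) => k ->.
  by rewrite block_mxEul row_mxEl [RHS]mxE.
by rewrite block_mxEdr row_mxEr [RHS]mxE.
Qed.

Lemma invmx_block_scalar n (a b : C) : a != 0 -> b != 0 ->
  invmx (block_mx a%:M 0 0 b%:M) = block_mx a^-1%:M 0 0 b^-1%:M :> 'M[C]_(n + n).
Proof.
move=> a0 b0; set M := block_mx _ _ _ _; set N := block_mx _ _ _ _.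
have MN : M *m N = 1%:M.
  rewrite mulmx_block !mulmx0 !mul0mx !addr0 add0r -!scalar_mxM !divff //.
  by rewrite -scalar_mx_block.
by have [uM _] := mulmx1_unit MN; rewrite -[LHS]mulmx1 -MN mulmxA mulVmx ?mul1mx.
Qed.

Lemma psumr_gt0 n (G : 'I_n -> C) j :
  (forall i, 0 <= G i) -> 0 < G j -> 0 < \sum_i G i.
Proof.
by move=> G0 Gj; rewrite (bigD1 j) //= ltr_wpDr // sumr_ge0.
Qed.

Lemma dotc_col_mx n1 n2 (u1 v1 : 'cV[C]_n1) (u2 v2 : 'cV[C]_n2) :
  dotc (col_mx u1 u2) (col_mx v1 v2) = dotc u1 v1 + dotc u2 v2.
Proof. by rewrite /dotc tr_col_mx map_row_mx mul_row_col mxE. Qed.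

Lemma dotc_fourier n (u v : 'cV[C]_n) : dotc (F n *m u) (F n *m v) = dotc u v.
Proof. by rewrite dotc_mulmxl mulmxA fourier_mx_adjK mul1mx. Qed.

(** * Two-grid convergence from conditions at each frequency *)

Section Form.
Variables (n : nat) (omega : R) (a h m : R -> C).
Let a0 := grid_mean n a.
Let h0 := grid_mean n h.
Hypotheses (omega_gt0 : 0 < omega) (a0_gt0 : 0 < a0) (h0_gt0 : 0 < h0).
Hypothesis smooth : forall j : 'I_n, smoothed_block omega%:C a0 h0
  (a (grid R n j)) (h (grid R n j)) (m (grid R n j)).

Let X : 'M[C]_(n + n) :=
  block_mx (circulant n a) (circulant n (fun t => (m t)^*))
           (circulant n (fun t => - m t)) (circulant n h).

Let pt (f : R -> C) (j : 'I_n) := f (grid R n j).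

Let aR j : (pt a j)^* = pt a j.
Proof. by have [aj _ _] := smooth j; apply/CrealP/ger0_real. Qed.

Let hR j : (pt h j)^* = pt h j.
Proof. by have [_ hj _] := smooth j; apply/CrealP/ger0_real. Qed.

Let block_fourier (f1 f2 f3 f4 : R -> C) (x y : 'cV[C]_n) :
  block_mx (circulant n f1) (circulant n f2) (circulant n f3) (circulant n f4)
    *m col_mx (F n *m x) (F n *m y) =
  col_mx (F n *m \col_j (pt f1 j * x j 0 + pt f2 j * y j 0))
         (F n *m \col_j (pt f3 j * x j 0 + pt f4 j * y j 0)).
Proof.
rewrite mul_block_col !circulant_mul_fourier -!mulmxDr.
by congr (col_mx _ _); congr (_ *m _); apply/colP => j; rewrite !mxE.
Qed.

Let fourierP (z : 'cV[C]_(n + n)) :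
  exists x y, z = col_mx (F n *m x) (F n *m y).
Proof.
exists ((F n)^t* *m usubmx z), ((F n)^t* *m dsubmx z).
by rewrite !mulmxA fourier_mxK !mul1mx vsubmxK.
Qed.

Let X_fourier x y : X *m col_mx (F n *m x) (F n *m y) =
  col_mx (F n *m \col_j (pt a j * x j 0 + (pt m j)^* * y j 0))
         (F n *m \col_j (- pt m j * x j 0 + pt h j * y j 0)).
Proof. exact: block_fourier. Qed.

(** The off-diagonal blocks are skew-adjoint to each other, so the cross terms cancel. *)
Let energy x y (z := col_mx (F n *m x) (F n *m y)) :
  dotc z (X *m z) + (dotc z (X *m z))^* =
  \sum_j 2 * (pt a j * `|x j 0| ^+ 2 + pt h j * `|y j 0| ^+ 2).
Proof.
rewrite X_fourier dotc_col_mx !dotc_fourier !dotcE -big_split rmorph_sum.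
rewrite -big_split; apply: eq_bigr => j _; rewrite !mxE !normCK.
rewrite !rmorphD !rmorphM !rmorphD !rmorphM rmorphN /= !conjCK aR hR; ring.
Qed.

Let kernel z : dotc z (X *m z) + (dotc z (X *m z))^* = 0 -> X^t* *m z = 0.
Proof.
have [x [y ->]] := fourierP z; rewrite energy => /eqP.
rewrite psumr_eq0 => [/allP xy0|j _]; last first.
  have [aj hj _] := smooth j.
  by rewrite mulr_ge0 // addr_ge0 // mulr_ge0 // exprn_ge0.
have xy j : pt a j * x j 0 - (pt m j)^* * y j 0 = 0 /\
            pt m j * x j 0 + pt h j * y j 0 = 0.
  apply: smoothed_block_kernel (smooth j) _; apply/eqP.
  by have := xy0 j; rewrite mem_index_enum mulf_eq0 pnatr_eq0 => /(_ isT).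
rewrite /X tr_block_mx map_block_mx !circulant_adj block_fourier.
rewrite [RHS](_ : _ = col_mx (F n *m 0) (F n *m 0)); last first.
  by rewrite !mulmx0 col_mx0.
congr (col_mx _ _); congr (_ *m _).
  apply/colP => j; rewrite !mxE /pt /= rmorphN mulNr -!/(pt _ _) aR.
  by have [-> _] := xy j.
apply/colP => j; rewrite !mxE /pt /= conjCK -!/(pt _ _) hR.
by have [_ ->] := xy j.
Qed.

Let smoothing w : X *m w != 0 ->
  0 < omega%:C * dotc (X *m w) (invmx (diag_part X) *m (X *m w))
    < dotc w (X *m w) + (dotc w (X *m w))^*.
Proof.
have [x [y ->]] := fourierP w; rewrite energy X_fourier.
set u := \col_j _; set v := \col_j _ => uv0.
(* A single frequency where [X w] is nonzero makes both inequalities strict. *)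
have [j uvj] : exists j, (u j 0 != 0) || (v j 0 != 0).
  apply/existsP; apply: contraNT uv0; rewrite negb_exists => /forallP uv.
  have [-> ->] : u = 0 /\ v = 0.
    by split; apply/colP => j; have := uv j; rewrite negb_or !negbK [RHS]mxE;
      case/andP => /eqP ? /eqP ?.
  by rewrite !mulmx0 col_mx0.
rewrite /X diag_part_block !diag_part_circulant -/a0 -/h0.
rewrite invmx_block_scalar ?lt0r_neq0 // mul_block_col !mul0mx addr0 add0r.
rewrite !mul_scalar_mx dotc_col_mx !dotcZr !dotc_fourier !dotcE !mulr_sumr.
rewrite -big_split mulr_sumr /=.
under [X in 0 < X < _]eq_bigr => i _ do
  rewrite ![_^* * _]mulrC -!normCK [a0^-1 * _]mulrC [h0^-1 * _]mulrC.
have sq_gt0 (p q : C) : 0 < p -> 0 < q ->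
    0 < p * `|u j 0| ^+ 2 + q * `|v j 0| ^+ 2.
  move=> p0 q0; case/orP: uvj => neq0.
    by rewrite ltr_wpDr ?mulr_ge0 ?mulr_gt0 ?exprn_ge0 ?exprn_gt0 ?normr_gt0 // ?ltW.
  by rewrite ltr_wpDl ?mulr_ge0 ?mulr_gt0 ?exprn_ge0 ?exprn_gt0 ?normr_gt0 // ?ltW.
have om0 : 0 < omega%:C by rewrite ltcR.
apply/andP; split.
  apply: (@psumr_gt0 _ _ j) => [i|].
    by rewrite mulr_ge0 ?(ltW om0) // addr_ge0 // mulr_ge0 ?exprn_ge0 ?invr_ge0 // ?ltW.
  by rewrite mulr_gt0 // ![_ / _]mulrC sq_gt0 ?invr_gt0.
rewrite -subr_gt0 -sumrB.
have gap i : exists p q : C, [/\ 0 < p, 0 < q &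
    2 * (pt a i * `|x i 0| ^+ 2 + pt h i * `|y i 0| ^+ 2) -
    omega%:C * (`|u i 0| ^+ 2 / a0 + `|v i 0| ^+ 2 / h0) =
    p * `|u i 0| ^+ 2 + q * `|v i 0| ^+ 2].
  have [p [q [p0 q0 pqE]]] := smoothed_block_energy a0_gt0 h0_gt0 (smooth i).
  exists p, q; split => //; have /= -> := pqE (x i 0) (y i 0).
  by rewrite !mxE addrAC subrr add0r.
apply: (@psumr_gt0 _ _ j) => [i|].
  have [p [q [p0 q0 ->]]] := gap i.
  by rewrite addr_ge0 // mulr_ge0 ?exprn_ge0 // ?ltW.
by have [p [q [p0 q0 ->]]] := gap j; exact: sq_gt0.
Qed.

Lemma block_circulant_TGM k (P : 'M[C]_(n + n, k)) :
  quot_spectral_radius X (TGM X P omega) < 1.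
Proof.
apply: quot_spectral_radius_lt1 => [v|lam]; first exact: TGM_ker.
exact: TGM_quot_eigenvalue.
Qed.

End Form.

End BlockCirculant.

(** * One coarsening step *)

Section CirculantLevel.
Variable R : realType.
Local Notation C := R[i].
Implicit Types f p : R -> C.

Lemma ge0_complexE (z : C) : 0 <= z -> z = (complex.Re z)%:C /\ 0 <= complex.Re z.
Proof. by case: z => x y; rewrite lecE /= => /andP[/eqP -> ->]. Qed.

Lemma gt0_complexE (z : C) : 0 < z -> z = (complex.Re z)%:C /\ 0 < complex.Re z.
Proof. by case: z => x y; rewrite ltcE /= => /andP[/eqP -> ->]. Qed.

Lemma sqr_normr_complex (z : C) : `|z| ^+ 2 = (normc z ^+ 2)%:C.
Proof. by rewrite normr_normc rmorphXn. Qed.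

Lemma grid_mean_ge0 n f : (forall j, (j < n)%N -> 0 <= f (grid R n j)) ->
  0 <= grid_mean n f.
Proof. by move=> f0; rewrite divr_ge0 ?ler0n // sumr_ge0 // => j _; apply: f0. Qed.

Lemma prolong_adj n p :
  (prolong n p)^t* = cut_mx R n *m circulant n (fun t => (p t)^*).
Proof.
rewrite /prolong adjmxM circulant_adj trmxK; congr (_ *m _).
by apply/matrixP => i j; rewrite !mxE rmorph_nat.
Qed.

Lemma galerkin_circulant n p f p' : ~~ odd n ->
  (prolong n p)^t* *m circulant n f *m prolong n p' =
  circulant n./2 (psi (fun t => (p t)^* * f t * p' t)).
Proof.
move=> n_even; rewrite prolong_adj -cut_circulant //.
have assoc (K : 'M[C]_(n./2, n)) (X Y Z : 'M[C]_n) (L : 'M[C]_(n, n./2)) :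
    K *m X *m Y *m (Z *m L) = K *m (X *m Y *m Z) *m L by rewrite !mulmxA.
apply: (etrans (assoc _ _ _ _ _)); congr (_ *m _ *m _).
exact: etrans (congr1 (mulmx^~ _) (circulantM _ _ _)) (circulantM _ _ _).
Qed.

Lemma vnorm2E n (v : 'cV[C]_n) : (vnorm2 v ^+ 2)%:C = dotc v v.
Proof.
rewrite dotcE /vnorm2 sqr_sqrtr; last by apply: sumr_ge0 => i _; rewrite sqr_ge0.
rewrite rmorph_sum; apply: eq_bigr => i _ /=.
by rewrite -sqr_normr_complex normCKC.
Qed.

Lemma vnorm2_ge0 n (v : 'cV[C]_n) : 0 <= vnorm2 v.
Proof. exact: sqrtr_ge0. Qed.

Lemma vnorm2Z n (c : C) (v : 'cV[C]_n) : vnorm2 (c *: v) = normc c * vnorm2 v.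
Proof.
apply: (@pexpIrn _ 2); rewrite ?nnegrE ?mulr_ge0 ?vnorm2_ge0 ?normc_ge0 //.
apply: (@complexI R); rewrite [LHS]vnorm2E exprMn.
rewrite [RHS]rmorphM [X in _ * X]vnorm2E -[X in X * _]sqr_normr_complex.
by rewrite dotcZr -[dotc _ v]conj_dotc dotcZr rmorphM /= conj_dotc mulrA normCK.
Qed.

(* [mxnorm2] is a supremum, which is 0 by convention if it does not exist. *)
Lemma le_mxnorm2_circulant n f (j : 'I_n) :
  0 <= (mxnorm2 (circulant n f))^-1 /\
  (mxnorm2 (circulant n f))^-1 * normc (f (grid R n j)) <= 1.
Proof.
rewrite /mxnorm2; set E := [set r | _].
have [hE|/sup_out ->] := pselect (has_sup E); last by rewrite invr0 mul0r.
have Ej : E (normc (f (grid R n j))).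
  (* A column of the Fourier matrix is a unit eigenvector, with eigenvalue the symbol at its grid
     point. *)
  pose v : 'cV[C]_n := fourier_mx R n *m delta_mx j 0.
  have v1 : vnorm2 v = 1.
    apply: (@pexpIrn _ 2); rewrite ?nnegrE ?vnorm2_ge0 //.
    apply: (@complexI R); rewrite vnorm2E dotc_fourier dotcE (bigD1 j) //= big1.
      by rewrite !mxE !eqxx conjC1 mulr1 addr0 expr1n.
    by move=> i /negPf ij; rewrite !mxE ij mulr0.
  exists v => //; rewrite circulant_mul_fourier.
  have -> : symbol_col f (delta_mx j 0) = f (grid R n j) *: delta_mx j 0.
    apply/colP => i; rewrite !mxE; case: (eqVneq i j) => [->|] //=.
    by rewrite !mulr0.
  by rewrite -scalemxAr vnorm2Z -/v v1 mulr1.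
have le_s := ub_le_sup (proj2 hE) Ej; set s := sup E in le_s *.
have s0 : 0 <= s := le_trans (normc_ge0 _) le_s.
split; first by rewrite invr_ge0.
have [->|sn0] := eqVneq s 0; first by rewrite invr0 mul0r.
by rewrite mulrC ler_pdivrMr ?mul1r // lt_def sn0.
Qed.

Lemma block_circulantM n (f1 f2 f3 f4 g1 g2 g3 g4 : R -> C) :
  block_mx (circulant n f1) (circulant n f2) (circulant n f3) (circulant n f4) *m
  block_mx (circulant n g1) (circulant n g2) (circulant n g3) (circulant n g4) =
  block_mx (circulant n (fun t => f1 t * g1 t + f2 t * g3 t))
           (circulant n (fun t => f1 t * g2 t + f2 t * g4 t))
           (circulant n (fun t => f3 t * g1 t + f4 t * g3 t))
           (circulant n (fun t => f3 t * g2 t + f4 t * g4 t)).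
Proof.
have circ2 (f f' g g' : R -> C) : circulant n f *m circulant n f' +
    circulant n g *m circulant n g' = circulant n (fun t => f t * f' t + g t * g' t).
  exact: etrans (congr2 +%R (circulantM _ _ _) (circulantM _ _ _)) (circulantD _ _ _).
rewrite mulmx_block; congr block_mx; exact: circ2.
Qed.

Lemma eq_block_circulant n (f1 f2 f3 f4 g1 g2 g3 g4 : R -> C) :
  (forall j, (j < n)%N -> f1 (grid R n j) = g1 (grid R n j)) ->
  (forall j, (j < n)%N -> f2 (grid R n j) = g2 (grid R n j)) ->
  (forall j, (j < n)%N -> f3 (grid R n j) = g3 (grid R n j)) ->
  (forall j, (j < n)%N -> f4 (grid R n j) = g4 (grid R n j)) ->
  block_mx (circulant n f1) (circulant n f2) (circulant n f3) (circulant n f4) =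
  block_mx (circulant n g1) (circulant n g2) (circulant n g3) (circulant n g4).
Proof.
by move=> /eq_circulant-> /eq_circulant-> /eq_circulant-> /eq_circulant->.
Qed.

(** * Symbols of the coarse matrices and of the transformed matrix *)

Section Step.
Local Opaque circulant.
Variables (n : nat) (F : level_syms R).
Let a := symA F.
Let b := symB F.
Let c := symC F.
Let M := LevelMats (circulant n a) (circulant n b) (circulant n c).
Hypothesis mean_a : fourier_coef 0 a = grid_mean n a.

Let al := mat_alpha M.
Let r : C := al%:C / fourier_coef 0 a.

Let diag_inv : invmx (diag_part (circulant n a)) =
  circulant n (fun=> (fourier_coef 0 a)^-1).
Proof. by rewrite diag_part_circulant invmx_scalar circulant_scalar mean_a. Qed.

Definition circE := (circulantM, circulantZ, circulantN, circulantD).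

Lemma mat_hatC_circulant : mat_hatC M = circulant n (sym_hatC al F).
Proof.
rewrite /mat_hatC /= -/al diag_inv circulant_adj !circE.
by apply: eq_circulant => j _; rewrite /sym_hatC -/a -/b -/c normCK; ring.
Qed.

Lemma coarse_mats_circulant pA pC : ~~ odd n ->
  let G := coarse_syms pA pC al F in
  coarse_mats pA pC M = LevelMats (circulant n./2 (symA G))
    (circulant n./2 (symB G)) (circulant n./2 (symC G)).
Proof.
move=> n_even /=; rewrite /coarse_mats /= mat_hatC_circulant -/al diag_inv.
have BE : circulant n b *m (1%:M - al%:C *:
    (circulant n (fun=> (fourier_coef 0 a)^-1) *m circulant n a)) =
    circulant n (fun t => b t * (1 - r * a t)).
  rewrite circulant_scalar !circE; apply: eq_circulant => j _; rewrite /r; ring.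
congr LevelMats.
- apply: (etrans (galerkin_circulant _ _ _ n_even)).
  by apply: eq_circulant => j _; rewrite /psi -/a !normCK; ring.
- rewrite -[X in X *m _ = _]mulmxA BE.
  apply: (etrans (galerkin_circulant _ _ _ n_even)).
  by apply: eq_circulant => j _; rewrite /psi /r -/a -/b; ring.
- apply: (etrans (galerkin_circulant _ _ _ n_even)).
  by apply: eq_circulant => j _; rewrite /psi !normCK; ring.
Qed.

(** Multiplying out, the lower left block is [alpha B D^-1 A - B = - B (I - r A)], and the terms in
    [B], [B^H] of the lower right block assemble into [hatC]. *)
Lemma mat_hat_circulant : mat_hat M =
  block_mx (circulant n a) (circulant n (fun t => (1 - r * a t) * (b t)^*))
           (circulant n (fun t => - (b t * (1 - r * a t))))
           (circulant n (sym_hatC al F)).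
Proof.
have z0 : 0 = circulant n (fun _ : R => 0 : C).
  by rewrite -(circulant_scalar n (0 : C)) raddf0.
rewrite /mat_hat /= -/al diag_inv circulant_adj.
rewrite z0 (circulant_scalar n 1) circulantM circulantZ !circulantN.
rewrite block_circulantM circulantM circulantZ circulantN block_circulantM.
apply: eq_block_circulant => j _;
  rewrite /sym_hatC /r -/a -/b -/c ?normCK; ring.
Qed.

(** As [al] is the inverse of a norm that dominates every [a / a0] on the grid, [r a <= 1] there and
    the factor [2 - r a] is at least 1. *)
Lemma sym_hatC_grid_ge0 :
  (forall j, (j < n)%N -> 0 <= a (grid R n j)) ->
  (forall j, (j < n)%N -> 0 <= c (grid R n j)) ->
  forall j, (j < n)%N -> 0 <= sym_hatC al F (grid R n j).
Proof.
move=> a0 c0 j jn; rewrite /sym_hatC -/a -/b -/c -/r.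
have [al0 alj] : 0 <= al /\
    al * normc ((fourier_coef 0 a)^-1 * a (grid R n j)) <= 1.
  rewrite /al /mat_alpha /= diag_inv circulantM.
  exact: (@le_mxnorm2_circulant n (fun t => (fourier_coef 0 a)^-1 * a t) (Ordinal jn)).
have m0 : 0 <= fourier_coef 0 a by rewrite mean_a; apply: grid_mean_ge0.
have r0 : 0 <= r by rewrite divr_ge0 // ler0c.
apply: addr_ge0; first exact: c0.
apply: mulr_ge0; first by rewrite mulr_ge0 ?exprn_ge0.
rewrite subr_ge0.
apply: (@le_trans _ _ 1); last by rewrite ler1n.
rewrite /r -mulrA -[_^-1 * _]ger0_norm ?mulr_ge0 ?invr_ge0 ?a0 // normr_normc.
by rewrite -rmorphM /= lecR.
Qed.

End Step.
End CirculantLevel.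

(** * The level recursion *)

Section Levels.
Variable R : realType.
Local Notation C := R[i].

Lemma grid_ge0 n j : 0 <= grid R n j.
Proof. by rewrite /grid divr_ge0 ?mulr_ge0 ?pi_ge0 ?ler0n. Qed.

Lemma grid_lt2pi n j : (j < n)%N -> grid R n j < 2 * pi.
Proof.
move=> jn; have n0 : 0 < n%:R :> R by rewrite ltr0n; lia.
have pi0 := pi_gt0 R.
by rewrite /grid ltr_pdivrMr // ltr_pM2l ?ltr_nat // mulr_gt0.
Qed.

Lemma grid_gt0 n j : (0 < j < n)%N -> 0 < grid R n j.
Proof.
move=> /andP[j0 jn]; have pi0 := pi_gt0 R.
by rewrite /grid divr_gt0 ?mulr_gt0 ?ltr0n //; lia.
Qed.

Lemma grid0 n : grid R n 0 = 0.
Proof. by rewrite /grid mulr0 mul0r. Qed.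

Lemma iter_half_exp2 b l : (l <= b)%N -> iter l half (2 ^ b)%N = (2 ^ (b - l))%N.
Proof.
elim: l => [|l IH] lb; first by rewrite subn0.
rewrite iterS IH; last by lia.
by rewrite (_ : b - l = (b - l.+1).+1)%N ?expnS ?mul2n ?doubleK //; lia.
Qed.

(** The sizes run [2 ^ b, ..., 2, 1, 0, 0, ...], so a positive even size forces [l < b]. *)
Lemma iter_half_exp2_even b l j : (0 < iter l half (2 ^ b)%N)%N ->
  ~~ odd (iter l half (2 ^ b)%N) -> (j <= l)%N ->
  (0 < iter j half (2 ^ b)%N)%N && ~~ odd (iter j half (2 ^ b)%N).
Proof.
move=> l0 l_even jl; have lb : (l < b)%N.
  rewrite ltnNge; apply/negP => bl; move: l0 l_even.
  rewrite -(subnK bl) iterD iter_half_exp2 // subnn expn0.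
  case: (l - b)%N => [|k] //; rewrite iterSr /=.
  by rewrite (_ : iter k half 0 = 0%N) //; elim: k => //= k ->.
rewrite iter_half_exp2; last by lia.
by rewrite expn_gt0 oddX /=; lia.
Qed.

Section FixedData.
Variables (S : mg_data R).
Hypothesis fA_0 : fA0 S 0 = 0.
Hypothesis fA_gt0 : forall t : R, 0 < t < 2 * pi -> 0 < fA0 S t.
Hypothesis fC_ge0 : forall t : R, 0 <= fC0 S t.
Hypothesis fB_0 : fB0 S 0 = 0.
Hypothesis pA_sum : forall t : R, 0 <= t <= 2 * pi ->
    0 < normc (pA S t) ^+ 2 + normc (pA S (t + pi)) ^+ 2.
Hypothesis pA_pi : pA S pi = 0.

(** [fA] is positive on the whole open interval because its recursion does not involve [alpha]; for
    [fC] only grid points are claimed, where [alpha] controls [fA]. *)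
Definition level_invariant j : Prop :=
  [/\ fA S j 0 = 0, forall t : R, 0 < t < 2 * pi -> 0 < fA S j t, fB S j 0 = 0,
      forall k, (k < nlev S j)%N -> 0 <= fC S j (grid R (nlev S j) k) &
      mats S j = LevelMats (circulant (nlev S j) (fA S j))
        (circulant (nlev S j) (fB S j)) (circulant (nlev S j) (fC S j))].

Lemma fA_grid_ge0 j : level_invariant j ->
  forall k, (k < nlev S j)%N -> 0 <= fA S j (grid R (nlev S j) k).
Proof.
move=> [A0 Apos _ _ _] [|k] kn; first by rewrite grid0 A0.
by rewrite ltW // Apos // grid_gt0 //= grid_lt2pi.
Qed.

Lemma fhatC_grid_ge0 j : level_invariant j -> trig_deg_lt (nlev S j) (fA S j) ->
  forall k, (k < nlev S j)%N -> 0 <= fhatC S j (grid R (nlev S j) k).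
Proof.
move=> inv degA k kn; have A0 := fA_grid_ge0 inv; have [_ _ _ C0 mE] := inv.
rewrite /fhatC /alpha mE.
exact: (@sym_hatC_grid_ge0 R _ (syms S j) (fourier_coef0_grid_mean degA)).
Qed.

(** The coarse point 0 receives the fine points 0 and [pi]: the symbols vanish at the former and
    [pA] at the latter. For other points both [t / 2] and [t / 2 + pi] lie in the open interval, and
    [pA] is nonzero at one of them. *)
Lemma level_invariantS j : ~~ odd (nlev S j) ->
  trig_deg_lt (nlev S j) (fA S j) -> level_invariant j -> level_invariant j.+1.
Proof.
move=> n_even degA inv; have hatC0 := fhatC_grid_ge0 inv degA.
have [A0 Apos B0 C0 mE] := inv.
have symsS : syms S j.+1 = coarse_syms (pA S) (pC S) (alpha S j) (syms S j) by [].
split.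
- rewrite /fA symsS /= /psi -/(fA S j) mul0r add0r pA_pi A0 normr0 expr0n.
  by rewrite mulr0 mul0r addr0 mul0r.
- move=> t /andP[t0 t2]; rewrite /fA symsS /= /psi -/(fA S j).
  have A1 : 0 < fA S j (t / 2) by apply: Apos; apply/andP; split; lra.
  have A2 : 0 < fA S j (t / 2 + pi) by apply: Apos; apply/andP; split; lra.
  have p0 (s : R) : 0 <= `|pA S s| ^+ 2 by rewrite exprn_ge0.
  have p12 : 0 < `|pA S (t / 2)| ^+ 2 + `|pA S (t / 2 + pi)| ^+ 2.
    rewrite !sqr_normr_complex -rmorphD /= ltcR pA_sum //.
    by apply/andP; split; lra.
  rewrite divr_gt0 //; have [p1|p1] := eqVneq (`|pA S (t / 2)| ^+ 2) 0.
    by move: p12; rewrite p1 mul0r !add0r => p2; rewrite mulr_gt0.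
  rewrite ltr_wpDr // ?mulr_ge0 ?(ltW A2) // mulr_gt0 //.
  by rewrite lt_def p1 p0.
- rewrite /fB symsS /= /psi -/(fB S j) mul0r add0r pA_pi B0.
  by rewrite !(mulr0, mul0r) addr0 mul0r.
- move=> k; rewrite -[nlev S j.+1]/((nlev S j)./2) => kn.
  (* A coarse grid point only draws on fine grid points, so nonnegativity of [fhatC] on the fine
     grid is enough. *)
  have [g1 g2] := @grid_half R (nlev S j) k n_even kn.
  rewrite /fC symsS /= /psi -/(fhatC S j) divr_ge0 // addr_ge0 // mulr_ge0 //;
    rewrite ?exprn_ge0 //.
    by rewrite -g1 hatC0 //; lia.
  by rewrite -g2 hatC0 //; lia.
- have aE : mat_alpha (LevelMats (circulant (nlev S j) (fA S j))
      (circulant (nlev S j) (fB S j)) (circulant (nlev S j) (fC S j))) = alpha S j.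
    by rewrite /alpha mE.
  have := @coarse_mats_circulant R _ (syms S j) (fourier_coef0_grid_mean degA)
    (pA S) (pC S) n_even.
  rewrite aE -symsS => coarseE.
  have matsS : mats S j.+1 = coarse_mats (pA S) (pC S) (mats S j) by reflexivity.
  rewrite matsS mE; exact: coarseE.
Qed.

End FixedData.
End Levels.

(** * Bounds on the symbols *)

Section Bounds.
Variable R : realType.
Local Notation C := R[i].
Implicit Types f : R -> C.

Lemma trig_deg_lt_trigpoly n f : trig_deg_lt n f -> trigpoly f.
Proof. by case=> d _ df; exists d. Qed.

Lemma continuous_sqr_normc f : trigpoly f -> continuous (fun t => normc (f t) ^+ 2).
Proof.
move=> tf; have -> : (fun t => normc (f t) ^+ 2) =
    (fun t => complex.Re (f t) ^+ 2 + complex.Im (f t) ^+ 2).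
  by apply/funext => t; rewrite normc_sqr.
move=> t; apply: cvgD; (under eq_fun do rewrite expr2); rewrite expr2.
  by apply: cvgM; apply: continuous_Re_trigpoly.
by apply: cvgM; apply: continuous_Im_trigpoly.
Qed.

(** To the right of 0, [|p (t + pi)|^2 <= M f t]; letting [t] tend to 0 sends the right side to
    [M f 0 = 0]. *)
Lemma trigpoly_eq0_limsup f p : trigpoly f -> trigpoly p ->
  f 0 = 0 -> (forall t : R, 0 < t < 2 * pi -> 0 < f t) ->
  (limsup_at0 (fun t => (normc (p (t + pi)) ^+ 2 / complex.Re (f t))%R) < +oo)%E ->
  p pi = 0.
Proof.
move=> tf tp f0 fpos /limsup_at0_lty[M HM]; have pi0 := pi_gt0 R.
have cp : {for 0, continuous (fun t => normc (p (t + pi)) ^+ 2)}.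
  apply: (@continuous_comp _ _ _ (fun t => t + pi) (fun t => normc (p t) ^+ 2)).
    by apply: cvgD; [exact: cvg_id | exact: cvg_cst].
  exact: continuous_sqr_normc.
have lim : normc (p (t + pi)) ^+ 2 - M * complex.Re (f t) @[t --> 0^'+] -->
    normc (p (0 + pi)) ^+ 2 - M * complex.Re (f 0).
  apply: cvg_at_right_filter; apply: cvgB; first exact: cp.
  by apply: cvgM; [exact: cvg_cst | exact: continuous_Re_trigpoly].
have : normc (p (0 + pi)) ^+ 2 - M * complex.Re (f 0) <= 0.
  apply: (cvgr_to_le lim); near=> t.
  have /fpos/gt0_complexE[_ ft] : 0 < t < 2 * pi.
    apply/andP; split; first by [].
    by near: t; apply: nbhs_right_lt; lra.
  rewrite subr_le0 -ler_pdivrMr //; by near: t.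
rewrite f0 add0r /= mulr0 subr0 => p0; apply: eq0_normc.
by apply/eqP; rewrite -sqrf_eq0 eq_le p0 sqr_ge0.
Unshelve. all: by end_near. Qed.

(** * Pointwise bounds from the essential supremum *)

Section Sup.
Variables fa fb fc : R -> C.
Hypotheses (ta : trigpoly fa) (tb : trigpoly fb) (tc : trigpoly fc).
Hypothesis fa_gt0 : forall t : R, 0 < t < 2 * pi -> 0 < fa t.

(** The symbol of the Schur complement [C + B A^-1 B^H]. *)
Let schur t := fc t + `|fb t| ^+ 2 / fa t.

Lemma le_supnorm_trigpoly t : 0 <= t < 2 * pi -> complex.Re (fa t) <= supnorm fa.
Proof.
move=> t02; apply: (@le_supnorm _ fa (fun s => complex.Re (fa s)) t) => //.
- exact: Lnorm_trigpoly_lty.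
- by apply: cvg_at_right_filter; exact: continuous_Re_trigpoly.
- by near=> s; exact: Re_le_normc.
Unshelve. all: by end_near. Qed.

Hypothesis schur_fin : supnorm schur != 0.

(** [supnorm] sends an infinite norm to 0, so a nonzero value certifies finiteness. *)
Let Lnorm_schur : (Lnorm lebesgue_measure +oo
    ((fun t : R => (normc (schur t))%:E) \_ `[0%R, (2 * pi)%R]) < +oo)%E.
Proof.
rewrite ltey; apply: contra_neq schur_fin; rewrite /supnorm => ->; exact: erefl.
Qed.

Let Re_schur t : 0 <= t < 2 * pi -> \forall s \near t^'+,
  complex.Re (fc s) + normc (fb s) ^+ 2 / complex.Re (fa s) <= normc (schur s) /\
  0 < complex.Re (fa s).
Proof.
move=> /andP[t0 t2]; near=> s.
have /fa_gt0/gt0_complexE[faE fas] : 0 < s < 2 * pi.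
  apply/andP; split; last by near: s; exact: nbhs_right_lt.
  by apply: le_lt_trans t0 _; near: s; exact: nbhs_right_gt.
split=> //; apply: le_trans (Re_le_normc _); rewrite /schur sqr_normr_complex faE.
rewrite -fmorphV -rmorphM /=; case: (fc s) => u v /=.
by rewrite lexx.
Unshelve. all: by end_near. Qed.

(** Dropping the nonnegative quotient leaves a continuous minorant, so the bound reaches [t = 0],
    where [fa] may vanish. *)
Lemma Re_le_supnorm_schur t : 0 <= t < 2 * pi -> complex.Re (fc t) <= supnorm schur.
Proof.
move=> t02; apply: (@le_supnorm _ schur (fun s => complex.Re (fc s)) t) => //.
  by apply: cvg_at_right_filter; exact: continuous_Re_trigpoly.
apply: filterS (Re_schur t02) => s [le_s fas]; apply: le_trans le_s.
by rewrite lerDl divr_ge0 ?sqr_ge0 // ltW.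
Qed.

Lemma schur_le_supnorm t : 0 <= t < 2 * pi -> 0 < complex.Re (fa t) ->
  complex.Re (fc t) + normc (fb t) ^+ 2 / complex.Re (fa t) <= supnorm schur.
Proof.
move=> t02 fat; apply: (@le_supnorm _ schur (fun s =>
  complex.Re (fc s) + normc (fb s) ^+ 2 / complex.Re (fa s)) t) => //.
  apply: cvg_at_right_filter; apply: cvgD; first exact: continuous_Re_trigpoly.
  apply: cvgM; first exact: continuous_sqr_normc.
  by apply: cvgV; [rewrite gt_eqF | exact: continuous_Re_trigpoly].
by apply: filterS (Re_schur t02) => s [].
Qed.

End Sup.

(** With [B = |b|^2], the determinant of the block collapses to [x z + B], free of [r]. The first
    bound on [om] suffices because [r x (2 - r x) <= 1], the second because [x z + B <= sQ x]. For
    [b = 0] the block is diagonal. *)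
Lemma smoothed_block_bounds (om al A0 H0 sA sQ x z : R) (b : C)
    (r := al / A0) :
  0 < om -> 0 < A0 -> 0 < sQ ->
  om < 2 * (2 * al - al ^+ 2 / A0 * sA) -> om < 2 * (H0 * sQ^-1) ->
  0 <= x <= sA -> 0 <= z <= sQ ->
  (b != 0 -> 0 < x /\ z + normc b ^+ 2 / x <= sQ) ->
  smoothed_block om%:C A0%:C H0%:C x%:C (z + r * normc b ^+ 2 * (2 - r * x))%:C
    (b * (1 - r * x)%:C).
Proof.
move=> om0 A00 sQ0 omA omQ /andP[x0 xsA] /andP[z0 zsQ] bx.
have A0n := lt0r_neq0 A00.
have alE : al = r * A0 by rewrite /r; field.
have omA' : om < 2 * (r * A0 * (2 - r * sA)).
  by rewrite (_ : r * A0 * _ = 2 * al - al ^+ 2 / A0 * sA) //; rewrite alE; field.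
clear omA; clearbody r; subst al.
have omQ' : om * sQ < 2 * H0 by rewrite -ltr_pdivlMr // -mulrA.
have sA0 : 0 <= sA by apply: le_trans xsA.
(* A nonpositive [r] would make the first upper bound on [om] nonpositive. *)
have r0 : 0 < r.
  rewrite ltNge; apply/negP => r0.
  have : r * A0 * (2 - r * sA) <= 0.
    rewrite -mulrA mulr_le0_ge0 // mulr_ge0 ?(ltW A00) // subr_ge0.
    by apply: (@le_trans _ _ 0) => //; rewrite mulr_le0_ge0.
  by lra.
have rsA : r * x <= r * sA by rewrite ler_pM2l.
have omx : om < 2 * (r * A0 * (2 - r * x)).
  apply: lt_le_trans omA' _; rewrite ler_pM2l // ler_pM2l ?mulr_gt0 //; lra.
have rx2 : r * x < 2.
  suff : 0 < 2 - r * x by lra.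
  by rewrite -(pmulr_rgt0 _ (mulr_gt0 r0 A00)); lra.
have rx1 : r * x * (2 - r * x) <= 1 by have := sqr_ge0 (1 - r * x); lra.
set B := normc b ^+ 2; have B0 : 0 <= B by exact: sqr_ge0.
have m2 : `|b * (1 - r * x)%:C| ^+ 2 = (B * (1 - r * x) ^+ 2)%:C.
  rewrite normrM exprMn !sqr_normr_complex (normc_sqr (_%:C)) /= expr0n addr0.
  by rewrite -/B -rmorphM.
have rB0 : 0 <= r * B * (2 - r * x).
  by rewrite mulr_ge0 ?subr_ge0 ?(ltW rx2) // mulr_ge0 // ltW.
split; [by rewrite ler0c | by rewrite ler0c addr_ge0 |].
have two : (2 : C) = (2 : R)%:C by rewrite rmorph_nat.
have [b0|bn0] := eqVneq b 0.
  left; rewrite b0 mul0r /B b0 normc0 expr0n /= mulr0 mul0r addr0.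
  rewrite two -!rmorphM /= !ltcR; split=> //.
    have [->|xn0] := eqVneq x 0; first by rewrite mulr0 mulr_gt0.
    have xpos : 0 < x by rewrite lt_def xn0.
    apply: (@lt_le_trans _ _ (2 * (r * A0 * (2 - r * x)) * x)).
      by rewrite ltr_pM2r.
    have : A0 * (r * x * (2 - r * x)) <= A0 * 1 by rewrite ler_pM2l.
    by lra.
  by apply: le_lt_trans omQ'; rewrite ler_pM2l.
have [xpos zB] := bx bn0; right.
have Bpos : 0 < B.
  by rewrite lt_def sqr_ge0 andbT sqrf_eq0; apply: contra_neq bn0; exact: eq0_normc.
have rBpos : 0 < r * B * (2 - r * x) by rewrite mulr_gt0 ?subr_gt0 // mulr_gt0.
set H := z + r * B * (2 - r * x).
have Hpos : 0 < H by rewrite ltr_wpDl.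
rewrite m2 two -!rmorphM -rmorphD -!rmorphM /= !ltcR.
have DE : x * H + B * (1 - r * x) ^+ 2 = x * z + B by rewrite /H; ring.
have Dpos : 0 < x * z + B by rewrite ltr_wpDl // mulr_ge0.
rewrite DE; split=> //.
  apply: (@lt_le_trans _ _ (2 * (r * A0 * (2 - r * x)) * (x * z + B))).
    by rewrite ltr_pM2r.
  have : A0 * (z * (r * x * (2 - r * x))) <= A0 * (z * 1).
    by rewrite ler_pM2l // ler_wpM2l.
  by rewrite /H; lra.
(* The determinant is [x] times the Schur complement value [z + B / x]. *)
have DsQ : x * z + B <= sQ * x.
  rewrite (_ : x * z + B = (z + B / x) * x) ?ler_pM2r //.
  by field; rewrite gt_eqF.
apply: (@le_lt_trans _ _ (om * (sQ * x))); first by rewrite ler_pM2l.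
by rewrite mulrA ltr_pM2r.
Qed.

End Bounds.

(* Re is taken only of quantities that the hypotheses make real. *)
Theorem theorem3 (R : realType) (S : mg_data R) (omega : nat -> R)
  (trig_fA : trigpoly (fA0 S)) (trig_fB : trigpoly (fB0 S))
  (trig_fC : trigpoly (fC0 S))
  (trig_pA : trigpoly (pA S)) (trig_pC : trigpoly (pC S))
  (fA_0 : fA0 S 0 = 0)
  (fA_gt0 : forall t : R, 0 < t < 2 * pi -> 0 < fA0 S t)
  (fC_ge0 : forall t : R, 0 <= fC0 S t)
  (fB_0 : fB0 S 0 = 0)
  (fB_neq0 : forall t : R, 0 < t < 2 * pi -> fB0 S t != 0)
  (fB_limsup :
    (limsup_at0 (fun t => (normc (fB0 S t) ^+ 2
                          / complex.Re (fA0 S t))%R)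
     < +oo)%E)
  (alpha_0 :
    0 < alpha S 0
      < 2 * complex.Re (fourier_coef 0 (fA0 S)) / supnorm (fA0 S))
  (pA_sum : forall t : R, 0 <= t <= 2 * pi ->
    0 < normc (pA S t) ^+ 2 + normc (pA S (t + pi)) ^+ 2)
  (pC_sum : forall t : R, 0 <= t <= 2 * pi ->
    0 < normc (pC S t) ^+ 2 + normc (pC S (t + pi)) ^+ 2)
  (pA_limsup :
    (limsup_at0 (fun t => (normc (pA S (t + pi)) ^+ 2
                          / complex.Re (fA0 S t))%R)
     < +oo)%E)
  (pC_limsup :
    (limsup_at0 (fun t => (normc (pC S (t + pi)) ^+ 2
                          / complex.Re (fhatC S 0 t))%R)
     < +oo)%E)
  (pApC_sum : forall t : R, 0 <= t <= 2 * pi ->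
    0 < normc (pA S t) ^+ 2 + normc (pC S (t + pi)) ^+ 2) :
  forall l, level_ok S l ->
    0 < omega l
      < 2 * Num.min
              (2 * alpha S l
               - alpha S l ^+ 2 / complex.Re (fourier_coef 0 (fA S l))
                 * supnorm (fA S l))
              (complex.Re (fourier_coef 0 (fhatC S l))
               * (supnorm (fun t => fC S l t
                                    + `|fB S l t| ^+ 2 / fA S l t))^-1) ->
    quot_spectral_radius (hatA S l) (TGM (hatA S l) (prol S l) (omega l)) < 1.
Proof.
move=> l [n0 n_even deg] /andP[om0 omlt].
have pA_pi := trigpoly_eq0_limsup trig_fA trig_pA fA_0 fA_gt0 pA_limsup.
have inv : level_invariant S l.
  suff : forall j, (j <= l)%N -> level_invariant S j by exact.
  elim=> [|j IH] jl; first by split=> //= k _; exact: fC_ge0.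
  have [/= _ j_even] := andP (iter_half_exp2_even n0 n_even (ltnW jl)).
  apply: level_invariantS => //; last exact/IH/ltnW.
  by have [] := deg j (ltnW jl).
have [degA degB degC degH] := deg l (leqnn l).
have [ta tb tc] := And3 (trig_deg_lt_trigpoly degA) (trig_deg_lt_trigpoly degB)
  (trig_deg_lt_trigpoly degC).
have meanA := fourier_coef0_grid_mean degA.
have meanH := fourier_coef0_grid_mean degH.
have A_ge0 := fA_grid_ge0 inv; have H_ge0 := fhatC_grid_ge0 inv degA.
have [A0 A_gt0 B0 C_ge0 matsE] := inv.
(* A positive even size is at least 2, so grid point 1 exists; [fA] is positive there, which makes
   its mean positive. *)
have n_gt1 : (1 < nlev S l)%N by move: n0 n_even; case: (nlev S l) => [|[]].
have mA_gt0 : 0 < grid_mean (nlev S l) (fA S l).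
  rewrite divr_gt0 ?ltr0n //; apply: (@psumr_gt0 _ _ _ (Ordinal n_gt1)) => [i|].
    exact: A_ge0.
  by apply: A_gt0; rewrite grid_gt0 // grid_lt2pi.
have [mAE mAR] := gt0_complexE mA_gt0.
have [mHE mHR] := ge0_complexE (grid_mean_ge0 H_ge0).
move: omlt; rewrite meanA meanH -ltr_pdivrMl // lt_min !ltr_pdivrMl //.
set A_ := complex.Re _ in mAE mAR *; set H_ := complex.Re _ in mHE mHR *.
set sQ := supnorm (fun t => _ + _); case/andP => omA omQ.
(* A positive damping forces the second bound to be positive, so [H_ > 0] and [sQ] is not the
   default value 0 of an infinite norm. *)
have sQinv : 0 < H_ * sQ^-1 by have := lt_trans om0 omQ; rewrite pmulr_rgt0.
have H_gt0 : 0 < H_.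
  by rewrite lt_def mHR andbT; apply: contraTneq sQinv => ->; rewrite mul0r ltxx.
have sQ0 : 0 < sQ by move: sQinv; rewrite pmulr_rgt0 // invr_gt0.
pose r := alpha S l / A_.
have rE : (alpha S l)%:C / fourier_coef 0 (fA S l) = r%:C.
  by rewrite meanA mAE -fmorphV -rmorphM.
pose m t := fB S l t * (1 - r%:C * fA S l t).
have aE k : (k < nlev S l)%N -> fA S l (grid R (nlev S l) k) =
    (complex.Re (fA S l (grid R (nlev S l) k)))%:C.
  by move=> kn; have [] := ge0_complexE (A_ge0 k kn).
have -> : hatA S l = block_mx (circulant (nlev S l) (fA S l))
    (circulant (nlev S l) (fun t => (m t)^*))
    (circulant (nlev S l) (fun t => - m t)) (circulant (nlev S l) (fhatC S l)).
  have alE : mat_alpha (LevelMats (circulant (nlev S l) (fA S l))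
      (circulant (nlev S l) (fB S l)) (circulant (nlev S l) (fC S l))) = alpha S l.
    by rewrite /alpha matsE.
  rewrite /hatA matsE; have := @mat_hat_circulant R _ (syms S l) meanA.
  rewrite alE rE => hatE; apply: (etrans hatE).
  (* On the grid [fA] is real, so the upper right symbol is the conjugate of [m]. *)
  have conjm (s : R) (b x : R[i]) : x^* = x ->
      (1 - s%:C * x) * b^* = (b * (1 - s%:C * x))^*.
    move=> xR; rewrite [RHS]rmorphM rmorphB rmorphM rmorph1 /= xR.
    by rewrite conj_real_complex mulrC.
  apply: eq_block_circulant => k kn;
    [exact: erefl | apply: conjm | exact: erefl | exact: erefl].
  by apply/CrealP/ger0_real; exact: A_ge0.
apply: block_circulant_TGM => //; first by rewrite mHE ltcR.
move=> k; have kn := ltn_ord k; have gk : 0 <= grid R (nlev S l) k < 2 * pi.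
  by rewrite grid_ge0 grid_lt2pi.
have [cE cR] := ge0_complexE (C_ge0 k kn).
have [_ aR] := ge0_complexE (A_ge0 k kn).
set t := grid R (nlev S l) k in gk cE cR aR *.
have hE : fhatC S l t = (complex.Re (fC S l t) +
    r * normc (fB S l t) ^+ 2 * (2 - r * complex.Re (fA S l t)))%:C.
  rewrite /fhatC /sym_hatC -/(fA S l) -/(fB S l) -/(fC S l) rE sqr_normr_complex.
  rewrite [in LHS]cE [in LHS](aE k kn).
  rewrite (_ : (2 : R[i]) = 2%:C); last by rewrite rmorph_nat.
  by rewrite -!rmorphM -rmorphB -rmorphM -rmorphD.
have mE : m t = fB S l t * (1 - r * complex.Re (fA S l t))%:C.
  by rewrite /m [in LHS](aE k kn) -rmorphM -[1 in LHS]/(1%:C) -rmorphB.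
rewrite mAE mHE hE mE (aE k kn); apply: (smoothed_block_bounds om0 mAR sQ0 omA omQ).
- by rewrite aR le_supnorm_trigpoly.
- by rewrite cR Re_le_supnorm_schur // lt0r_neq0.
(* A nonzero value of [fB] excludes grid point 0, and [fA] is positive at all the others. *)
- move=> bn0; have a_gt0 : 0 < complex.Re (fA S l t).
    have /gt0_complexE[] : 0 < fA S l t; last by [].
    apply: A_gt0; case/andP: gk => _ ->; rewrite andbT grid_gt0 // kn andbT.
    by rewrite lt0n; apply: contraNneq bn0 => k0; rewrite /t k0 grid0 B0.
  by split=> //; apply: schur_le_supnorm => //; rewrite lt0r_neq0.
Qed.
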